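(* Assume that $(K,v)$ is a henselian valued field and let $f\in K[X]\setminus K$. Then $$[K(X)^h:K(f(X))^h]\le h_K(X:f).$$
   Context: Setting: $(K,v)$ is a valued field with $\operatorname{char}K=p$ an odd prime, $X$ is transcendental over $K$, and $(K(X)|K,w)$ is an immediate extension of valued fields ($wK(X)=vK$ and $K(X)w=Kv$). Fix an extension of $w$ to the algebraic closure $\overline{K(X)}$, again denoted $w$; for a subfield $E$ of $K(X)$, $E^h$ denotes the henselization of $(E,w)$ inside $\overline{K(X)}$ with respect to this extension. A sequence $\{z_\nu\}_{\nu<\lambda}\subset K$ ($\lambda$ a limit ordinal) is pseudo-convergent if $v(z_\nu-z_\mu)<v(z_\mu-z_\rho)$ for all $\nu<\mu<\rho<\lambda$. Put $\gamma_\nu:=v(z_\nu-z_{\nu+1})$; an element $Y\in\overline{K(X)}$ is a limit of the sequence if $w(Y-z_\nu)=\gamma_\nu$ for all $\nu<\lambda$. Fix a pseudo-convergent sequence $\mathcal C=\{z_\nu\}_{\nu<\lambda}\subset K$ without a limit in $K$ and with $X$ as a limit (one exists since $(K(X)|K,w)$ is immediate). Relative approximation degree: for $f\in K[X]$, if there exist $\nu_0<\lambda$, a positive integer $h$ and $\beta\in vK$ with $w(f(X)-f(z_\nu))=\beta+h\,w(X-z_\nu)$ for all $\nu_0<\nu<\lambda$, then $h_K(X:f):=h$. When $(K,v)$ is henselian, $h_K(X:f)$ exists for every $f\in K[X]\setminus K$. *)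

(* Defs.v *)
From HB Require Import structures.
From mathcomp Require Import all_boot all_order all_algebra.
From mathcomp Require Import wochoice boolp classical_sets.

Set Implicit Arguments.
Unset Strict Implicit.
Unset Printing Implicit Defensive.

Import Order.TTheory GRing.Theory Num.Theory.

Local Open Scope classical_set_scope.
Local Open Scope ring_scope.

(* A [porderZmodType] carries no compatibility between order and addition. *)
Definition ordered_abelian_group (G : porderZmodType) : Prop :=
  total (<=%R : rel G) /\ forall x y z : G, x <= y -> x + z <= y + z.

(* [option G] stands for G extended by infinity, which is [None]. *)
Section ExtendedGroup.
Variable G : porderZmodType.
Implicit Types a b : option G.

Definition vadd a b : option G :=
  if (a, b) is (Some x, Some y) then Some (x + y) else None.

Definition vle a b : bool :=
  match a, b with
  | _, None => true
  | None, Some _ => false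
  | Some x, Some y => x <= y
  end.

Definition vlt a b : bool := ~~ (a == b) && vle a b.

Definition vmin a b : option G := if vle a b then a else b.

Definition vmuln a (n : nat) : option G := omap (fun x => x *+ n) a.

End ExtendedGroup.

Record valuation (G : porderZmodType) (F : fieldType) (w : F -> option G) :
    Prop := Valuation {
  valuation_eq_infty : forall x, w x = None <-> x = 0;
  valuationM : forall x y, w (x * y) = vadd (w x) (w y);
  valuationD : forall x y, vle (vmin (w x) (w y)) (w (x + y))
}.

Definition is_subfield (F : fieldType) (E : set F) : Prop :=
  GRing.divring_closed (mem E).

Section ValuedSubfields.
Variables (G : porderZmodType) (F : fieldType) (w : F -> option G).
Implicit Types E L : set F.

Definition value_group E : set G := [set g | exists2 x, E x & w x = Some g].

Definition valuation_ring E : set F := [set x | E x /\ vle (Some 0) (w x)].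

Definition residue_class (x : F) : set F := [set y | vlt (Some 0) (w (y - x))].

(* The residue field of E, embedded in the residue field of F: it consists of
   cosets of the maximal ideal of the valuation ring of F. *)
Definition residue_field E : set (set F) := residue_class @` valuation_ring E.

Definition immediate E L : Prop :=
  value_group L = value_group E /\ residue_field L = residue_field E.

(* (E, w) satisfies Hensel's Lemma. *)
Definition henselian E : Prop :=
  forall (q : {poly F}) (b : F),
    (forall i, valuation_ring E q`_i) -> valuation_ring E b ->
    vlt (Some 0) (w q.[b]) -> w q^`().[b] = Some 0 ->
    exists a, [/\ valuation_ring E a, root q a & vlt (Some 0) (w (a - b))].

(* For F algebraically closed, this is the henselization of (E, w) inside F:
   the least henselian subfield of F containing E. (Roots given by Hensel's
   Lemma are unique, so that henselian subfields are closed under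
   intersection.) *)
Definition henselization E : set F :=
  smallest (fun L => is_subfield L /\ henselian L) E.

End ValuedSubfields.

Definition algebraic_over (F : fieldType) (E : set F) (y : F) : Prop :=
  exists q : {poly F}, [/\ q != 0, forall i, E q`_i & root q y].

Definition extension_degree (F : fieldType) (E L : set F) (n : nat) : Prop :=
  E `<=` L /\
  exists s : 'I_n -> F, (forall i, L (s i)) /\
    forall y, L y ->
      exists! c : 'rV[F]_n,
        (forall i, E (c 0 i)) /\ y = \sum_(i < n) c 0 i * s i.

(* The subfield K(y) of Omega. *)
Definition adjoin (K Omega : fieldType) (iota : {rmorphism K -> Omega})
    (y : Omega) : set Omega :=
  smallest (@is_subfield Omega) (range iota `|` [set y]).

(* Limit ordinals are represented as well-ordered types. *)
Section Sequences.
Variables (d : Order.disp_t) (I : orderType d).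

Definition limit_ordinal : Prop :=
  [/\ well_order (<=%O : rel I), (exists i : I, True)
    & forall i : I, exists j : I, (i < j)%O].

Definition is_succ (i j : I) : Prop :=
  (i < j)%O /\ forall k : I, (i < k)%O -> (j <= k)%O.

Variables (G : porderZmodType) (K : fieldType) (v : K -> option G).

Definition pseudo_convergent (z : I -> K) : Prop :=
  forall i j k : I, (i < j)%O -> (j < k)%O ->
    vlt (v (z i - z j)) (v (z j - z k)).

Variables (Omega : fieldType) (w : Omega -> option G).
Variable iota : {rmorphism K -> Omega}.

Definition is_pseudo_limit (z : I -> K) (Y : Omega) : Prop :=
  forall i j : I, is_succ i j -> w (Y - iota (z i)) = v (z i - z j).

Definition is_approximation_degree (z : I -> K) (X : Omega) (f : {poly K})
    (h : nat) : Prop :=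
  (0 < h)%N /\
  exists (i0 : I) (beta : G), value_group v [set: K] beta /\
    forall i : I, (i0 < i)%O ->
      w ((map_poly iota f).[X] - iota f.[z i]) =
        vadd (Some beta) (vmuln (w (X - iota (z i))) h).

(* This is h_K(X : f); the value is 0 if the degree does not exist. *)
Definition approximation_degree (z : I -> K) (X : Omega) (f : {poly K}) : nat :=
  xget 0%N [set h | is_approximation_degree z X f h].

End Sequences.

(* Main.v *)
(* Let y = f(X) and let E be the henselization of K(y). Roots of a minimal
   polynomial over a henselian field all have the same value, a property that
   passes to algebraic extensions and gives back Hensel's Lemma; hence E(X) is
   henselian and K(X)^h = E(X) has degree deg mu, where mu is the minimal
   polynomial of X over E. For a = z_nu, every conjugate r of X satisfies
   w(r - a) = w(X - a), so that t = (r - X) / (a - X) is integral. These t are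
   roots of f(X + (a - X) T) - f(X), and by Kaplansky's argument, for nu large,
   a single term of its Taylor expansion dominates, that of degree
   h = h_K(X : f). So modulo the maximal ideal this polynomial is, up to
   scaling, T^h, and it has at most h integral roots.

   That a henselian field has the stated property: if the set S of the indices
   of the k roots of minimal value is proper, then among the products of k
   roots the one over S has strictly least value; Hensel's Lemma, applied to
   the polynomial whose roots are these products divided by their sum, shows
   that it lies in E, and Lagrange interpolation over the k-subsets then gives
   that the product of the T - r_i for i in S is a proper factor over E. *)
Require Import Defs.
From HB Require Import structures.
From mathcomp Require Import all_boot all_order all_algebra.
From mathcomp Require Import wochoice boolp classical_sets.
From mathcomp Require Import perm.
From mathcomp Require mpoly.

Set Implicit Arguments.
Unset Strict Implicit.
Unset Printing Implicit Defensive.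

Import Order.TTheory GRing.Theory Num.Theory.

Local Open Scope classical_set_scope.
Local Open Scope ring_scope.

(** * Valuation rings *)

Section OrderedGroup.
Variable G : porderZmodType.
Hypothesis hG : ordered_abelian_group G.
Implicit Types x y z : G.

Lemma oag_leD2r z x y : (x + z <= y + z) = (x <= y).
Proof.
apply/idP/idP => [/(hG.2 _ _ (- z))|]; last exact: hG.2.
by rewrite !addrK.
Qed.

Lemma oag_ltD2r z x y : (x + z < y + z) = (x < y).
Proof. by rewrite !lt_neqAle oag_leD2r (inj_eq (addIr z)). Qed.

Lemma oag_total x y : (x <= y) || (y <= x).
Proof. exact: hG.1. Qed.

Lemma oag_ltNge x y : (x < y) = ~~ (y <= x).
Proof.
apply/idP/idP => [xy|nyx]; first by apply/negP => /(lt_le_trans xy); rewrite ltxx.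
have /orP[xy|yx] := oag_total x y; last by rewrite yx in nyx.
by rewrite lt_neqAle xy andbT; apply: contra nyx => /eqP ->.
Qed.

Lemma oag_addr_ge0 x y : 0 <= x -> 0 <= y -> 0 <= x + y.
Proof. by move=> x0 y0; apply: le_trans y0 _; rewrite -{1}[y]add0r oag_leD2r. Qed.

Lemma oag_addr_gt0 x y : 0 < x -> 0 <= y -> 0 < x + y.
Proof. by move=> x0 y0; apply: le_lt_trans y0 _; rewrite -{1}[y]add0r oag_ltD2r. Qed.

(** Torsion is excluded by the total order; this case yields $w(-1) = 0$ from $2w(-1) = w(1) =
    0$. *)
Lemma oag_double_eq0 x : x + x = 0 -> x = 0.
Proof.
move=> xx; have /orP[x0|x0] := oag_total 0 x.
  apply/le_anti; rewrite x0 andbT.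
  by rewrite -(oag_leD2r x) xx add0r.
apply/le_anti; rewrite x0 /=.
by rewrite -(oag_leD2r x) xx add0r.
Qed.

Lemma oag_oppr_ge0 x : (0 <= - x) = (x <= 0).
Proof. by rewrite -[LHS](oag_leD2r x) add0r addNr. Qed.

Lemma oag_oppr_gt0 x : (0 < - x) = (x < 0).
Proof. by rewrite -[LHS](oag_ltD2r x) add0r addNr. Qed.

Lemma oag_mulrn_gt0 x n : 0 < x -> (0 < n)%N -> 0 < x *+ n.
Proof.
move=> x0; elim: n => // -[|n] IHn _; first by rewrite mulr1n.
by rewrite mulrS; apply: oag_addr_gt0 => //; exact/ltW/IHn.
Qed.

End OrderedGroup.

(** The proofs [hG] and [wv] are arguments so that the subring structure declared below is inferred
    from the predicate itself. *)
Definition vring (G : porderZmodType) (hG : ordered_abelian_group G)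
    (F : fieldType) (w : F -> option G) (wv : valuation w) : {pred F} :=
  fun x => vle (Some 0) (w x).

Definition videal (G : porderZmodType) (F : fieldType) (w : F -> option G) :
    {pred F} :=
  fun x => vlt (Some 0) (w x).

Section Valuation.
Variables (G : porderZmodType) (hG : ordered_abelian_group G).
Variables (F : fieldType) (w : F -> option G) (wv : valuation w).
Local Notation O := (vring hG wv).
Local Notation M := (videal w).
Implicit Types x y : F.

Lemma val0 : w 0 = None.
Proof. exact/(valuation_eq_infty wv). Qed.

Lemma val_neq0 x : x != 0 -> exists g, w x = Some g.
Proof.
move=> x0; case e: (w x) => [g|]; first by exists g.
by move/(valuation_eq_infty wv): e x0 => ->; rewrite eqxx.
Qed.

Lemma val_some_neq0 x g : w x = Some g -> x != 0.
Proof. by move=> wx; apply/eqP => x0; rewrite x0 val0 in wx. Qed.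

Lemma val1 : w 1 = Some 0.
Proof.
have [g wg] := val_neq0 (oner_neq0 F).
have := valuationM wv 1 1; rewrite mulr1 wg /= => -[gg]; congr Some.
by apply: (addrI g); rewrite addr0.
Qed.

Lemma valN1 : w (- 1) = Some 0.
Proof.
have m1 : -1 != 0 :> F by rewrite oppr_eq0 oner_neq0.
have [g wg] := val_neq0 m1.
have := valuationM wv (-1) (-1); rewrite mulrNN mulr1 val1 wg /= => -[gg].
by rewrite (oag_double_eq0 hG (esym gg)).
Qed.

Lemma valN x : w (- x) = w x.
Proof.
rewrite -mulN1r (valuationM wv) valN1 /=.
by case: (w x) => [g|]; rewrite /vadd ?add0r.
Qed.

Lemma valV x g : w x = Some g -> w x^-1 = Some (- g).
Proof.
move=> wx; have x0 := val_some_neq0 wx.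
have [k wk] := val_neq0 (invr_neq0 x0).
have := valuationM wv x x^-1; rewrite divff // val1 wx wk /= => -[gk].
by congr Some; apply/eqP; rewrite -addr_eq0 addrC -gk.
Qed.

Lemma valX x n g : w x = Some g -> w (x ^+ n) = Some (g *+ n).
Proof.
move=> wx; elim: n => [|n IHn]; first by rewrite expr0 val1.
by rewrite exprS (valuationM wv) wx IHn /= mulrS.
Qed.

Fact vring_closed : GRing.subring_closed (vring hG wv).
Proof.
have OD x y : O x -> O y -> O (x + y).
  rewrite /vring; have := valuationD wv x y.
  case: (w x) (w y) (w (x + y)) => [a|] [b|] [c|] //=; rewrite /vmin /=.
  - case: ifP => _ /= ab a0 b0; [exact: le_trans a0 ab|exact: le_trans b0 ab].
  - exact: (fun ab a0 _ => le_trans a0 ab).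
  - exact: (fun ab _ a0 => le_trans a0 ab).
have OM x y : O x -> O y -> O (x * y).
  rewrite /vring (valuationM wv); case: (w x) (w y) => [a|] [b|] //=.
  exact: oag_addr_ge0.
split=> [|x y Ox Oy|x y]; first by rewrite -topredE /= /vring val1 /=.
- by apply: OD => //; rewrite /vring valN.
- exact: OM.
Qed.

End Valuation.

HB.instance Definition _ (G : porderZmodType) (hG : ordered_abelian_group G)
    (F : fieldType) (w : F -> option G) (wv : valuation w) :=
  GRing.isSubringClosed.Build F (vring hG wv) (vring_closed hG wv).

Section ValuationIdeal.
Variables (G : porderZmodType) (hG : ordered_abelian_group G).
Variables (F : fieldType) (w : F -> option G) (wv : valuation w).
Local Notation O := (vring hG wv).
Local Notation M := (videal w).
Implicit Types x y : F.

Lemma vringE x : (x \in O) = vle (Some 0) (w x).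
Proof. by []. Qed.

Lemma videalE x : (x \in M) = vlt (Some 0) (w x).
Proof. by []. Qed.

Lemma vlt0S (g : G) : vlt (Some 0) (Some g) = (0 < g).
Proof. by rewrite /vlt /= lt_neqAle; congr (_ && _). Qed.

(** Values are mostly compared through membership in $O$ and $M$; this translates the condition
    $w(q'(b)) = 0$ of Hensel's Lemma. *)
Lemma vunitE x : (w x = Some 0) <-> (x \in O /\ x \notin M).
Proof.
rewrite vringE videalE; split=> [->|[]]; first by rewrite vlt0S ltxx /=.
case: (w x) => //= g g0; rewrite vlt0S (oag_ltNge hG) negbK => g0'.
by congr Some; apply/le_anti; rewrite g0 g0'.
Qed.

Lemma videalW x : x \in M -> x \in O.
Proof. by rewrite vringE videalE => /andP[]. Qed.

Lemma videal1 : 1 \notin M.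
Proof. by rewrite videalE (val1 wv) vlt0S ltxx. Qed.

Lemma videal0 : 0 \in M.
Proof. by rewrite videalE (val0 wv). Qed.

Lemma videalMr x y : x \in M -> y \in O -> x * y \in M.
Proof.
rewrite vringE !videalE (valuationM wv); case: (w x) (w y) => [a|] [b|] //=.
by rewrite !vlt0S; exact: oag_addr_gt0.
Qed.

Lemma videalMl x y : x \in O -> y \in M -> x * y \in M.
Proof. by rewrite mulrC => Ox My; exact: videalMr. Qed.

Lemma videalN x : (- x \in M) = (x \in M).
Proof. by rewrite !videalE (valN hG wv). Qed.

Lemma vringV x : x \notin M -> x^-1 \in O.
Proof.
rewrite vringE videalE; case e: (w x) => [g|] //; rewrite (valV wv e) /= vlt0S.
by rewrite (oag_ltNge hG) negbK (oag_oppr_ge0 hG).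
Qed.

Lemma vring_notinV x : x \notin O -> x^-1 \in M.
Proof.
rewrite vringE videalE; case e: (w x) => [g|] //; rewrite (valV wv e) /= vlt0S.
by rewrite (oag_oppr_gt0 hG) (oag_ltNge hG).
Qed.

Lemma videal_neq0 x : x \notin M -> x != 0.
Proof. by apply: contraNneq => ->; exact: videal0. Qed.

Lemma videalV x : x != 0 -> x \in M -> x^-1 \notin O.
Proof.
move=> x0 Mx; apply/negP => Ox; have := videalMr Mx Ox.
by rewrite divff // (negPf videal1).
Qed.

(** One of $x/y$ and $y/x$ is integral, so the sum is a summand times an integral element. *)
Lemma videalD x y : x \in M -> y \in M -> x + y \in M.
Proof.
move=> Mx My; have [->|x0] := eqVneq x 0; first by rewrite add0r.
have [->|y0] := eqVneq y 0; first by rewrite addr0.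
have [Oxy|nO] := boolP (x / y \in O).
  have -> : x + y = y * (x / y + 1) by rewrite mulrDr mulr1 mulrC divfK.
  by apply: videalMr => //; rewrite rpredD ?rpred1.
have -> : x + y = x * (1 + y / x) by rewrite mulrDr mulr1 [x * _]mulrC divfK.
apply: videalMr => //; rewrite rpredD ?rpred1 //.
by have := videalW (vring_notinV nO); rewrite invf_div.
Qed.

Lemma videalB x y : x \in M -> y \in M -> x - y \in M.
Proof. by move=> Mx My; rewrite videalD ?videalN. Qed.

Lemma videal_sum (I : Type) (r : seq I) (P : pred I) (E : I -> F) :
  (forall i, P i -> E i \in M) -> \sum_(i <- r | P i) E i \in M.
Proof. by move=> ME; elim/big_ind: _ => //; [exact: videal0|exact: videalD]. Qed.

(** Elements outside $M$ have integral inverses, so $xy \in M$ would give $1 \in M$. *)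
Lemma videal_prime x y : x \notin M -> y \notin M -> x * y \notin M.
Proof.
move=> nx ny; apply/negP => Mxy.
have := videalMr Mxy (rpredM (vringV nx) (vringV ny)).
rewrite mulrACA !divff ?videal_neq0 // mulr1; exact/negP/videal1.
Qed.

Lemma videal_addNr x y : x \notin M -> y \in M -> x + y \notin M.
Proof.
by move=> nx My; apply: contra nx => Mxy; rewrite -[x](addrK y) videalB.
Qed.

Lemma vltE x y : x != 0 -> vlt (w x) (w y) = (y / x \in M).
Proof.
move=> x0; have [g wx] := val_neq0 wv x0.
rewrite videalE (valuationM wv) wx (valV wv wx); case: (w y) => [k|] //=.
rewrite vlt0S /vlt /=; have -> : (Some g == Some k) = (g == k) by [].
by rewrite -lt_neqAle -(oag_ltD2r hG g 0) add0r subrK.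
Qed.

Lemma val_eq x y : x / y \in O -> x / y \notin M -> w x = w y.
Proof.
move=> Oxy Nxy; have y0 : y != 0.
  by apply: contraNneq Nxy => ->; rewrite invr0 mulr0 videal0.
rewrite -[in LHS](divfK y0 x) (valuationM wv).
have /vunitE -> : x / y \in O /\ x / y \notin M by [].
by case: (w y) => [k|]; rewrite /vadd ?add0r.
Qed.

End ValuationIdeal.

Arguments videalMr [G] hG [F w] wv [x y].
Arguments videalMl [G] hG [F w] wv [x y].
Arguments val_eq [G] hG [F w] wv [x y].

(** * Minimal polynomials over a subfield *)

Section PolyOver.
Variables (F : fieldType) (S : subringClosed F).
Implicit Types D q : {poly F}.

(** Long division by a monic polynomial stays over the subring; uniqueness of quotient and remainder
    identifies the result with [%/] and [%%]. *)
Lemma polyOver_monic_divmod D q :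
    D \is monic -> D \is a polyOver S -> q \is a polyOver S ->
  q %/ D \is a polyOver S /\ q %% D \is a polyOver S.
Proof.
move=> monD SD Sq.
suff [Q [R [SQ SR sR ->]]] : exists Q R, [/\ Q \is a polyOver S,
    R \is a polyOver S, (size R < size D)%N & q = Q * D + R].
  have e : Q * D + R = Q * D + R by [].
  by rewrite -(divpP e sR) -(modpP e sR).
have [n] := ubnP (size q); elim: n q Sq => // n IHn q Sq /ltnSE sq.
have [lt_qD|le_Dq] := ltnP (size q) (size D).
  by exists 0, q; rewrite mul0r add0r rpred0.
have q0 : q != 0.
  rewrite -size_poly_gt0; apply: leq_trans le_Dq.
  by rewrite size_poly_gt0 monic_neq0.
pose t := lead_coef q *: 'X^(size q - size D).
have St : t \is a polyOver S.
  by rewrite polyOverZ ?polyOverXn // lead_coefE; apply: (polyOverP Sq).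
have t0 : t != 0 by rewrite scaler_eq0 negb_or lead_coef_eq0 q0 monic_neq0 ?monicXn.
have szt : size (t * D) = size q.
  rewrite (size_mul t0 (monic_neq0 monD)) /t size_scale ?lead_coef_eq0 //.
  by rewrite size_polyXn addSn /= subnK.
have szr : (size (q - t * D)%R < n)%N.
  apply: leq_trans sq; rewrite -(prednK (_ : 0 < size q)%N) ?size_poly_gt0 //.
  rewrite ltnS; apply/leq_sizeP => j; rewrite leq_eqVlt => /orP[/eqP <-|lt_j].
    have := lead_coefM t D; rewrite (monicP monD) mulr1 lead_coefZ lead_coefXn.
    by rewrite mulr1 !lead_coefE szt coefB => ->; rewrite subrr.
  have le_j : (size q <= j)%N by rewrite -[size q]prednK ?size_poly_gt0.
  by rewrite coefB !nth_default ?subrr // szt.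
have [|Q [R [SQ SR sR eqR]]] := IHn (q - t * D) _ szr.
  by rewrite rpredB ?rpredM.
exists (t + Q), R; split=> //; first exact: rpredD.
by rewrite mulrDl -addrA -eqR addrC subrK.
Qed.

Lemma polyOver_dvd_monic D q :
    D \is monic -> D \is a polyOver S -> q \is a polyOver S -> D %| q ->
  exists2 Q, Q \is a polyOver S & q = Q * D.
Proof.
move=> monD SD Sq /divpK eq_q; exists (q %/ D); last by rewrite eq_q.
by have [] := polyOver_monic_divmod monD SD Sq.
Qed.

Lemma polyOver_horner_diff q x : q \is a polyOver S -> x \in S ->
  exists2 Q, Q \is a polyOver S & q = Q * ('X - x%:P) + (q.[x])%:P.
Proof.
move=> Sq Sx; have [] := @polyOver_dvd_monic ('X - x%:P) (q - (q.[x])%:P).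
- exact: monicXsubC.
- by rewrite polyOverXsubC.
- by rewrite rpredB // polyOverC rpred_horner.
- by rewrite dvdp_XsubCl /root !hornerE subrr.
by move=> Q SQ /eqP; rewrite subr_eq => /eqP eq_q; exists Q.
Qed.

End PolyOver.

Section MinimalPolynomial.
Variables (F : fieldType) (E : divringClosed F).
Implicit Types (g mu : {poly F}) (x : F).

(** $E[T]$ is represented by the polynomials over $F$ with coefficients in $E$, so divisibility is
    that of $F[T]$; quotients by monic divisors over $E$ are again over $E$. *)
Definition minimal_polynomial x mu : Prop :=
  [/\ mu \is monic, mu \is a polyOver E, root mu x
    & forall g, g \is a polyOver E -> root g x -> mu %| g].

Lemma polyOver_monic_scale g : g \is a polyOver E -> g != 0 ->
  (lead_coef g)^-1 *: g \is monic /\ (lead_coef g)^-1 *: g \is a polyOver E.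
Proof.
move=> Eg g0; split.
  by rewrite monicE lead_coefZ mulVf // lead_coef_eq0.
by rewrite polyOverZ // rpredV lead_coefE (polyOverP Eg).
Qed.

Lemma minimal_polynomial_exists x g : g \is a polyOver E -> g != 0 -> root g x ->
  exists mu, minimal_polynomial x mu.
Proof.
move=> Eg g0 rg.
pose P n := `[< exists g, [/\ g \is a polyOver E, g != 0, root g x & size g = n] >].
have exP : exists n, P n by exists (size g); apply/asboolP; exists g.
case: (ex_minnP exP) => m /asboolP[nu [Enu nu0 rnu szm]] m_min.
have [monmu Emu] := polyOver_monic_scale Enu nu0.
set mu := _ *: _ in monmu Emu; exists mu.
have lc0 : (lead_coef nu)^-1 != 0 by rewrite invr_eq0 lead_coef_eq0.
split=> //; first by rewrite rootZ.
move=> h Eh rh; apply: contraT => ndvd.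
have [_ Er] := polyOver_monic_divmod monmu Emu Eh.
suff : (m <= size (h %% mu)%R)%N.
  rewrite leqNgt; case/negP; rewrite -szm -(size_scale nu lc0).
  by rewrite ltn_modp monic_neq0.
apply: m_min; apply/asboolP; exists (h %% mu); split=> //.
have := rh; rewrite {1}(divp_eq h mu) rootE hornerD hornerM.
by rewrite (rootP (_ : root mu x)) ?rootZ // mulr0 add0r.
Qed.

Lemma minimal_polynomial_leq x mu g : minimal_polynomial x mu ->
  g \is a polyOver E -> g != 0 -> root g x -> (size mu <= size g)%N.
Proof. by case=> _ _ _ mu_min Eg g0 rg; apply: dvdp_leq g0 (mu_min _ Eg rg). Qed.

(** This is irreducibility: $x$ is a root of $D$ or of its cofactor, and minimality gives that
    factor the full degree. *)
Lemma minimal_polynomial_factor x mu D :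
    minimal_polynomial x mu -> D \is monic -> D \is a polyOver E -> D %| mu ->
  size D = 1%N \/ size D = size mu.
Proof.
move=> mu_min monD ED dvd; have [monmu Emu rmu _] := mu_min.
have [Q EQ eq_mu] := polyOver_dvd_monic monD ED Emu dvd.
have mu0 := monic_neq0 monmu; have D0 := monic_neq0 monD.
have Q0 : Q != 0 by apply: contraNneq mu0 => Q0; rewrite eq_mu Q0 mul0r.
have szmu := size_mul Q0 D0; rewrite -eq_mu in szmu.
have Qgt0 : (0 < size Q)%N by rewrite size_poly_gt0.
have Dgt0 : (0 < size D)%N by rewrite size_poly_gt0.
move: rmu; rewrite {1}eq_mu rootM => /orP[rQ|rD].
  left; have := minimal_polynomial_leq mu_min EQ Q0 rQ; rewrite szmu.
  rewrite -(prednK Qgt0) -(prednK Dgt0) addSn /= addnS ltnS.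
  by rewrite -[X in (_ <= X)%N -> _]addn0 leq_add2l leqn0 => /eqP ->.
right; apply/eqP; rewrite eqn_leq (minimal_polynomial_leq mu_min) // andbT.
exact: dvdp_leq mu0 dvd.
Qed.

End MinimalPolynomial.

(** * Hensel's Lemma and henselizations *)

Section IntegralPolynomials.
Variables (G : porderZmodType) (hG : ordered_abelian_group G).
Variables (F : fieldType) (w : F -> option G) (wv : valuation w).
Local Notation O := (vring hG wv).
Local Notation M := (videal w).
Implicit Types D g q : {poly F}.

(* Gauss: modulo the maximal ideal, g has degree h and is a multiple of D. *)
Lemma integral_divisor_size D g h :
    D \is monic -> D \is a polyOver O -> g \is a polyOver O -> D %| g ->
    g`_h \notin M -> (forall i, (h < i)%N -> g`_i \in M) ->
  (size D <= h.+1)%N.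
Proof.
move=> monD OD Og dvd g_h g_gt.
have [Q OQ eq_g] := polyOver_dvd_monic monD OD Og dvd.
have exQ : exists j, Q`_j \notin M.
  apply: contrapT => /forallNP allM; case/negP: g_h; rewrite eq_g coefM.
  apply: (videal_sum hG wv) => i _; apply: (videalMr hG wv); last exact: (polyOverP OD).
  by have /negP := allM i; rewrite negbK.
have leQ j : Q`_j \notin M -> (j <= size Q)%N.
  move=> nM; rewrite leqNgt; apply: contra nM => /ltnW/(nth_default 0)->.
  by rewrite (videal0 wv).
(* With $j$ the degree of $Q$ modulo $M$, the coefficient of $g$ of index $j + \deg D$ is congruent
   to $Q_j$, as $D$ is monic. *)
case: (ex_maxnP exQ leQ) => j nQj max_j {exQ leQ}.
have D0 : (0 < size D)%N by rewrite size_poly_gt0 monic_neq0.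
have : g`_(j + (size D).-1) \notin M.
  rewrite eq_g coefM.
  have lt_j : (j < (j + (size D).-1).+1)%N by rewrite ltnS leq_addr.
  rewrite (bigD1 (Ordinal lt_j)) //= addKn -lead_coefE (monicP monD) mulr1.
  apply: (videal_addNr hG wv) => //; apply: (videal_sum hG wv) => i ne_ij.
  have [lt_ji|lt_ij|eq_ij] := ltngtP j i; last first.
  - by case/negP: ne_ij; apply/eqP/val_inj.
  - rewrite [D`__]nth_default ?mulr0 ?(videal0 wv) //.
    by rewrite -{1}(prednK D0) ltn_subRL ltn_add2r.
  apply: (videalMr hG wv); last exact: (polyOverP OD).
  by apply: contraT => /max_j; rewrite leqNgt lt_ji.
rewrite -(prednK D0) ltnS => nM; apply: leq_trans (leq_addl j _) _.
by rewrite leqNgt; apply: contra nM; exact: g_gt.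
Qed.

Lemma hornerNvideal_near q a b : q \is a polyOver O -> b \in O ->
  q.[b] \notin M -> a - b \in M -> q.[a] \notin M.
Proof.
move=> Oq Ob nqb Ma; have Oa : a \in O.
  by rewrite -(subrK b a) rpredD // (videalW hG wv).
have [R OR eq_q] := polyOver_horner_diff Oq Ob.
rewrite eq_q !hornerE addrC (videal_addNr hG wv) // (videalMl hG wv) //.
exact: rpred_horner.
Qed.

(** Write $q = Q(T - a)$. Then $q'(b) \equiv Q(b)$ modulo $M$, so $Q(b) \notin M$, hence $Q(c)
    \notin M$, and $q(c) = 0$ forces $c = a$. *)
Lemma hensel_root_unique q b a c :
    q \is a polyOver O -> b \in O -> q^`().[b] \notin M ->
    root q a -> a - b \in M -> root q c -> c - b \in M ->
  a = c.
Proof.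
move=> Oq Ob dq ra Ma rc Mc.
have Oa : a \in O by rewrite -(subrK b a) rpredD // (videalW hG wv Ma).
have [Q OQ eq_q] := polyOver_horner_diff Oq Oa.
rewrite (rootP ra) addr0 in eq_q.
have nQb : Q.[b] \notin M.
  move: dq; rewrite eq_q derivM derivXsubC mulr1 !hornerE; apply: contra => MQ.
  rewrite (videalD hG wv) // (videalMl hG wv) ?rpred_horner ?polyOver_deriv //.
  by rewrite -(videalN hG wv) opprB.
have nQc := hornerNvideal_near OQ Ob nQb Mc.
move/rootP/eqP: rc; rewrite eq_q hornerM mulf_eq0 (negPf (videal_neq0 wv nQc)).
by rewrite !hornerE subr_eq0 => /eqP.
Qed.

End IntegralPolynomials.

Section Henselization.
Variables (G : porderZmodType) (hG : ordered_abelian_group G).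
Variables (F : closedFieldType) (w : F -> option G) (wv : valuation w).
Local Notation O := (vring hG wv).
Local Notation M := (videal w).
Implicit Types (q : {poly F}) (E : set F).

(* If no root is close to b, then q'(b) / q(b), which is the sum of the
   1 / (b - r) over the roots r of q, is integral. *)
Lemma closed_hensel q b : q \is a polyOver O -> q.[b] \in M ->
  q^`().[b] \notin M -> exists2 a, root q a & a - b \in M.
Proof.
move=> Oq qb dq; apply: contrapT => no_root.
have [rs eq_q] := closed_field_poly_normal q.
have far r : r \in rs -> b - r \notin M.
  move=> rs_r; apply/negP => Mr; apply: no_root; exists r.
    by rewrite eq_q rootE hornerZ (rootP (_ : root _ r)) ?mulr0 ?root_prod_XsubC.
  by rewrite -(videalN hG wv) opprB.
suff [c Oc eq_c] : exists2 c, c \in O & q^`().[b] = q.[b] * c.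
  by case/negP: dq; rewrite eq_c (videalMr hG wv).
rewrite eq_q derivZ !hornerZ.
suff [c Oc ->] : exists2 c, c \in O &
    (\prod_(z <- rs) ('X - z%:P))^`().[b] = (\prod_(z <- rs) ('X - z%:P)).[b] * c.
  by exists c; rewrite // mulrA.
elim: rs far {eq_q} => [|r rs IHrs] far.
  by exists 0; rewrite ?rpred0 // big_nil derivC hornerC mulr0.
have [z rs_z|c Oc eq_c] := IHrs; first by apply: far; rewrite inE rs_z orbT.
have nr : b - r \notin M by apply: far; rewrite inE eqxx.
exists ((b - r)^-1 + c); first by rewrite rpredD // (vringV hG wv).
rewrite big_cons derivM derivXsubC mul1r hornerD !hornerM eq_c hornerXsubC.
by rewrite mulrDr mulrA [_ * _ / _]mulrC mulKf ?(videal_neq0 wv nr).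
Qed.
End Henselization.

(** The argument [hE] lets the closure under field operations be inferred. *)
Definition subfield_pred (F : fieldType) (E : set F) (hE : is_subfield E) :
    {pred F} :=
  fun x => x \in E.

Fact subfield_pred_closed (F : fieldType) (E : set F) (hE : is_subfield E) :
  GRing.divring_closed (subfield_pred hE).
Proof. exact: hE. Qed.

HB.instance Definition _ (F : fieldType) (E : set F) (hE : is_subfield E) :=
  GRing.isDivringClosed.Build F (subfield_pred hE) (subfield_pred_closed hE).

Lemma subfield_predP (F : fieldType) (E : set F) (hE : is_subfield E) x :
  reflect (E x) (x \in subfield_pred hE).
Proof. exact: asboolP. Qed.

Lemma is_subfieldP (F : fieldType) (E : set F) :
    E 1 -> (forall x y, E x -> E y -> E (x - y)) ->
    (forall x y, E x -> E y -> E (x / y)) ->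
  is_subfield E.
Proof.
move=> E1 EB Ediv; split=> [|x y|x y]; rewrite !in_setE //; [exact: EB|exact: Ediv].
Qed.

(** An intersection of subfields is a subfield; this serves [adjoin] and [henselization] alike. *)
Lemma smallest_subfield (F : fieldType) (C : set F -> Prop) (A : set F) :
  (forall L, C L -> is_subfield L) -> is_subfield (smallest C A).
Proof.
move=> CF; apply: is_subfieldP => [|x y Sx Sy|x y Sx Sy] L [CL AL];
  apply/(subfield_predP (CF L CL)).
- exact: rpred1.
- by apply: rpredB; apply/subfield_predP; [apply: Sx|apply: Sy].
- by apply: rpred_div; apply/subfield_predP; [apply: Sx|apply: Sy].
Qed.

Lemma adjoin_subfield (K Omega : fieldType) (iota : {rmorphism K -> Omega}) y :
  is_subfield (adjoin iota y).
Proof. exact: smallest_subfield. Qed.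

Lemma adjoin_gen (K Omega : fieldType) (iota : {rmorphism K -> Omega}) y :
  adjoin iota y y.
Proof. by apply: sub_gen_smallest; right. Qed.

Lemma adjoin_base (K Omega : fieldType) (iota : {rmorphism K -> Omega}) y c :
  adjoin iota y (iota c).
Proof. by apply: sub_gen_smallest; left; exists c. Qed.

Section HenselianSubfields.
Variables (G : porderZmodType) (hG : ordered_abelian_group G).
Variables (F : fieldType) (w : F -> option G) (wv : valuation w).
Variables (E : set F) (hE : is_subfield E).
Local Notation O := (vring hG wv).
Local Notation M := (videal w).
Local Notation "'E" := (subfield_pred hE).
Implicit Types q : {poly F}.

Lemma henselianP :
  henselian w E <->
  forall q b, q \is a polyOver 'E -> q \is a polyOver O -> b \in 'E -> b \in O ->
    q.[b] \in M -> q^`().[b] \notin M ->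
  exists a, [/\ a \in 'E, root q a & a - b \in M].
Proof.
split=> hens q b.
  move=> Eq Oq Eb Ob qb dqb; have [|||| a [[Ea Oa] ra Ma]] := hens q b.
  - by move=> i; split; [exact/(subfield_predP hE)/(polyOverP Eq)|exact: (polyOverP Oq)].
  - by split=> //; exact/(subfield_predP hE).
  - by [].
  - by apply/(vunitE hG wv); split=> //; rewrite rpred_horner ?polyOver_deriv.
  by exists a; split=> //; exact/subfield_predP.
move=> EOq [Eb Ob] qb dqb.
have [| | | | | |a [Ea ra Ma]] := hens q b.
- by apply/polyOverP => i; apply/subfield_predP; have [] := EOq i.
- by apply/polyOverP => i; have [] := EOq i.
- exact/subfield_predP.
- by [].
- by [].
- by have /(vunitE hG wv)[] := dqb.
exists a; split=> //; split; first exact/(subfield_predP hE).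
suff : a \in O by [].
by rewrite -(subrK b a) rpredD // (videalW hG wv Ma).
Qed.

End HenselianSubfields.

Section HenselizationSubfield.
Variables (G : porderZmodType) (hG : ordered_abelian_group G).
Variables (F : closedFieldType) (w : F -> option G) (wv : valuation w).
Implicit Types A L : set F.

Lemma henselization_subfield A : is_subfield (henselization w A).
Proof. by apply: smallest_subfield => L []. Qed.

(** The root near $b$ in the algebraically closed field is, by uniqueness, the one found in each
    henselian subfield containing $A$, hence lies in their intersection. *)
Lemma henselization_henselian A : henselian w (henselization w A).
Proof.
apply/(henselianP hG wv (henselization_subfield A)) => q b Eq Oq Eb Ob qb dqb.
have [a ra Ma] := closed_hensel Oq qb dqb.
exists a; split=> //; apply/subfield_predP => L [[hL hensL] AL].
have /(henselianP hG wv hL) := hensL.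
have toL x : x \in subfield_pred (henselization_subfield A) -> x \in subfield_pred hL.
  by move=> /subfield_predP Hx; apply/subfield_predP; exact: Hx.
case/(_ q b); rewrite ?toL //.
  by apply/polyOverP => i; apply: toL; exact: (polyOverP Eq).
move=> c [Lc rc Mc]; rewrite (hensel_root_unique Oq Ob dqb ra Ma rc Mc).
exact/(subfield_predP hL).
Qed.

Lemma sub_henselization A : A `<=` henselization w A.
Proof. exact: sub_gen_smallest. Qed.

Lemma henselization_min A L :
  is_subfield L -> henselian w L -> A `<=` L -> henselization w A `<=` L.
Proof. by move=> hL hensL; apply: smallest_sub. Qed.

End HenselizationSubfield.

(** * Symmetric functions of roots *)

Section SymmetricFunctions.
Import mpoly.
Variables (F : fieldType) (S : subringClosed F) (n : nat) (r : 'I_n -> F).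
Hypothesis Sr : \prod_(i < n) ('X - (r i)%:P) \is a polyOver S.

Lemma mesym_roots_over k : mmap intr r (mesym n int k) \in S.
Proof.
have [lt_kn|le_nk] := ltnP k n.+1; last by rewrite mesym_geqnE // mmap0 rpred0.
pose cs := [tuple r i | i < n].
have eq_cs i : tnth cs i = r i by rewrite tnth_mktuple.
have eq_s : mmap intr r (mesym n int k) = (mesym n F k).@[tnth cs].
  rewrite /mesym !raddf_sum /=; apply/eq_bigr => h _.
  by rewrite !rmorph_prod /=; apply/eq_bigr => j _; rewrite mmapX mmap1U mevalXU eq_cs.
have eq_p : \prod_(c <- cs) ('X - c%:P) = \prod_(i < n) ('X - (r i)%:P).
  by rewrite big_tuple; apply: eq_bigr => i _; rewrite eq_cs.
(* Vieta: the coefficient is $(-1)^k e_k$, and a second factor $(-1)^k$ clears the sign. *)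
have := mroots_coeff cs (Ordinal lt_kn); rewrite /= -eq_s eq_p.
move=> /(congr1 ( *%R ((-1) ^+ k))); rewrite mulrA -expr2 sqrr_sign mul1r => <-.
by rewrite rpredM ?rpredX ?rpredN ?rpred1 // (polyOverP Sr).
Qed.

Lemma symmetric_roots_over (q : {mpoly int[n]}) :
  q \is symmetric -> mmap intr r q \in S.
Proof.
move=> /sym_fundamental[t [<- _]].
rewrite /comp_mpoly [X in mmap _ _ X]/mmap raddf_sum /=.
apply: rpred_sum => m _; rewrite rmorphM /= mmapC rpredM ?rpred_int //.
rewrite /mmap1 rmorph_prod /=; apply: rpred_prod => i _.
by rewrite rmorphXn /= rpredX // tnth_mktuple mesym_roots_over.
Qed.

Lemma symmetric_poly_roots_over (q : {poly {mpoly int[n]}}) :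
    (forall s, map_poly (msym s) q = q) ->
  map_poly (mmap intr r) q \is a polyOver S.
Proof.
move=> sym_q; apply/polyOverP => i; rewrite coef_map /=.
apply: symmetric_roots_over; apply/issymP => s.
by rewrite -[in RHS](sym_q s) coef_map.
Qed.

End SymmetricFunctions.

(** * Symmetric expressions in the subsets of size $k$ *)

Section SymmetricFamilies.
Import mpoly.
Variables (F : fieldType) (S : subringClosed F) (n : nat) (r : 'I_n -> F).
Hypothesis Sr : \prod_(i < n) ('X - (r i)%:P) \is a polyOver S.
Variable k : nat.
Implicit Types A B : {set 'I_n}.

Let rprod A := \prod_(i in A) r i.
(** [mprod] and [mfactor] are generic, with indeterminates for the roots: a permutation $s$ carries
    the object of $A$ to that of $s(A)$, so sums and products over all $k$-subsets are symmetric. *)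
Let mprod A : {mpoly int[n]} := \prod_(i in A) 'X_i.
Let mfactor A : {poly {mpoly int[n]}} := \prod_(i in A) ('X - ('X_i)%:P).

Let mmap_mprod A : mmap intr r (mprod A) = rprod A.
Proof. by rewrite rmorph_prod; apply: eq_bigr => i _; rewrite /= mmapX mmap1U. Qed.

Let msym_var (s : 'S_n) i : msym s 'X_i = 'X_(s i) :> {mpoly int[n]}.
Proof. by rewrite /msym mmapX mmap1U. Qed.

Let msym_mprod (s : 'S_n) A : msym s (mprod A) = mprod (s @: A)%SET.
Proof.
rewrite rmorph_prod /mprod big_imset /=; last exact: (in2W (@perm_inj _ s)).
by apply: eq_bigr => i _; rewrite msym_var.
Qed.

Let msym_mfactor (s : 'S_n) A :
  map_poly (msym s) (mfactor A) = mfactor (s @: A)%SET.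
Proof.
rewrite rmorph_prod /mfactor big_imset /=; last exact: (in2W (@perm_inj _ s)).
by apply: eq_bigr => i _; rewrite rmorphB /= map_polyX map_polyC /= msym_var.
Qed.

Let mmap_mfactor A :
  map_poly (mmap intr r) (mfactor A) = \prod_(i in A) ('X - (r i)%:P).
Proof.
rewrite rmorph_prod; apply: eq_bigr => i _.
by rewrite rmorphB /= map_polyX map_polyC /= mmapX mmap1U.
Qed.

Let card_perm_imset (s : 'S_n) A : #|(s @: A)%SET| = #|A|.
Proof. exact/card_imset/perm_inj. Qed.

Let imset_perm_inj (s : 'S_n) : injective (fun A : {set 'I_n} => (s @: A)%SET).
Proof. exact/imset_inj/perm_inj. Qed.

Lemma sum_subset_prod_over : \sum_(A : {set 'I_n} | #|A| == k) rprod A \in S.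
Proof.
pose q : {mpoly int[n]} := \sum_(A : {set 'I_n} | #|A| == k) mprod A.
have <- : mmap intr r q = \sum_(A : {set 'I_n} | #|A| == k) rprod A.
  by rewrite raddf_sum; apply: eq_bigr => A _; exact: mmap_mprod.
apply: symmetric_roots_over => //; apply/issymP => s.
rewrite /q raddf_sum [RHS](reindex_inj (@imset_perm_inj s)) /=.
by apply: eq_big => [A|A _]; rewrite ?card_perm_imset ?msym_mprod.
Qed.

Lemma prod_subset_XsubC_over :
  \prod_(A : {set 'I_n} | #|A| == k) ('X - (rprod A)%:P) \is a polyOver S.
Proof.
pose q : {poly {mpoly int[n]}} :=
  \prod_(A : {set 'I_n} | #|A| == k) ('X - (mprod A)%:P).
suff <- : map_poly (mmap intr r) q =
    \prod_(A : {set 'I_n} | #|A| == k) ('X - (rprod A)%:P).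
  apply: symmetric_poly_roots_over => // s.
  rewrite /q rmorph_prod [RHS](reindex_inj (@imset_perm_inj s)) /=.
  apply: eq_big => [A|A _]; rewrite ?card_perm_imset //.
  by rewrite rmorphB /= map_polyX map_polyC /= msym_mprod.
rewrite rmorph_prod; apply: eq_bigr => A _.
by rewrite rmorphB /= map_polyX map_polyC /= mmap_mprod.
Qed.

(** Lagrange interpolation without division: at [rprod A] every summand but that of $A$ vanishes,
    leaving the $j$-th coefficient of the factor over $A$ times the differences of the nodes. *)
Lemma lagrange_subset_over j :
  \sum_(A : {set 'I_n} | #|A| == k) (\prod_(i in A) ('X - (r i)%:P))`_j *:
     \prod_(B : {set 'I_n} | (#|B| == k) && (B != A)) ('X - (rprod B)%:P)
  \is a polyOver S.
Proof.
pose q : {poly {mpoly int[n]}} :=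
  \sum_(A : {set 'I_n} | #|A| == k) (mfactor A)`_j *:
     \prod_(B : {set 'I_n} | (#|B| == k) && (B != A)) ('X - (mprod B)%:P).
set p := \sum_(A | _) _.
suff <- : map_poly (mmap intr r) q = p.
  apply: symmetric_poly_roots_over => // s.
  rewrite /q raddf_sum [RHS](reindex_inj (@imset_perm_inj s)) /=.
  apply: eq_big => [A|A _]; rewrite ?card_perm_imset //.
  rewrite map_polyZ /= -coef_map msym_mfactor rmorph_prod; congr (_ *: _).
  rewrite [RHS](reindex_inj (@imset_perm_inj s)) /=.
  apply: eq_big => [B|B _]; first by rewrite card_perm_imset (inj_eq (@imset_perm_inj s)).
  by rewrite rmorphB /= map_polyX map_polyC /= msym_mprod.
rewrite raddf_sum /=; apply: eq_bigr => A _.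
rewrite map_polyZ /= -coef_map mmap_mfactor rmorph_prod; congr (_ *: _).
apply: eq_bigr => B _.
by rewrite rmorphB /= map_polyX map_polyC /= mmap_mprod.
Qed.

End SymmetricFamilies.

(** * Values of conjugates over a henselian field *)

Section ConjugateValues.
Variables (G : porderZmodType) (hG : ordered_abelian_group G).
Variables (F : closedFieldType) (w : F -> option G) (wv : valuation w).
Variables (E : set F) (hE : is_subfield E) (hensE : henselian w E).
Local Notation O := (vring hG wv).
Local Notation M := (videal w).
Local Notation "'E" := (subfield_pred hE).

Section SeparatedFactor.
Variables (n : nat) (r : 'I_n -> F) (S : {set 'I_n}) (i0 : 'I_n).
Hypothesis Er : \prod_(i < n) ('X - (r i)%:P) \is a polyOver 'E.
Hypothesis ri0 : r i0 != 0.
Hypothesis O_r : forall i, r i / r i0 \in O.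
Hypothesis S_r : forall i, (i \in S) = (r i / r i0 \notin M).
Implicit Types A B : {set 'I_n}.

Local Notation pi A := (\prod_(i in A) r i).

Let pi_scale A : pi A = \prod_(i in A) (r i / r i0) * r i0 ^+ #|A|.
Proof.
rewrite -prodr_const -big_split /=; apply: eq_bigr => i _.
by rewrite divfK.
Qed.

Let unitS : \prod_(i in S) (r i / r i0) \notin M.
Proof.
by elim/big_ind: _ => [|x y|i]; [exact: videal1|exact: videal_prime|rewrite S_r].
Qed.

Let piS_neq0 : pi S != 0.
Proof. by rewrite pi_scale mulf_neq0 ?expf_neq0 ?(videal_neq0 wv unitS). Qed.

(** Equal cardinalities make the powers of $r_{i_0}$ cancel; $A$ has an index outside $S$, whose
    normalized root lies in $M$, while the normalized product over $S$ lies outside $M$. *)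
Lemma subset_prod_dominated A : #|A| = #|S| -> A != S -> pi A / pi S \in M.
Proof.
move=> cardA neAS; rewrite !pi_scale cardA -mulf_div divff ?expf_neq0 // mulr1.
apply: (videalMr hG wv); last exact: vringV unitS.
have /subsetPn[j Aj nSj] : ~~ (A \subset S).
  by apply: contra neAS => subAS; rewrite eqEcard subAS cardA leqnn.
rewrite (bigD1 j) //=; apply: (videalMr hG wv); last by apply: rpred_prod => i _.
by move: nSj; rewrite S_r negbK.
Qed.

Local Notation e := (\sum_(A : {set 'I_n} | #|A| == #|S|) pi A).

Lemma subset_sum_dominated :
  [/\ e / pi S - 1 \in M, pi S / e \in O, pi S / e - 1 \in M & e != 0].
Proof.
have Me : e / pi S - 1 \in M.
  rewrite mulr_suml (bigD1 S) //= divff // addrAC subrr add0r.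
  apply: (videal_sum hG wv) => A /andP[/eqP cardA neAS].
  exact: subset_prod_dominated.
have ne : e / pi S \notin M.
  rewrite -[e / _](subrK 1) addrC.
  by apply: (videal_addNr hG wv) => //; exact: videal1 wv.
have e0 : e != 0.
  by apply: contraNneq ne => ->; rewrite mul0r (videal0 wv).
have Oe : pi S / e \in O by rewrite -invf_div (vringV hG wv).
split=> //; rewrite -(videalN hG wv) opprB.
have -> : 1 - pi S / e = (e / pi S - 1) * (pi S / e).
  by rewrite mulrBl mul1r mulf_div [pi S * e]mulrC divff // mulf_neq0.
exact: (videalMr hG wv).
Qed.

(** Modulo $M$ the polynomial with roots $\pi(A)/e$ is a power of $T$ times $T - 1$; Hensel's Lemma
    lifts the simple root $1$ to $\pi(S)/e$. *)
Lemma dominant_subset_prod_in : pi S \in 'E.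
Proof.
have [_ Ou Mu e0] := subset_sum_dominated.
have Ee : e \in 'E by exact: sum_subset_prod_over.
have Mrho A : #|A| = #|S| -> A != S -> pi A / e \in M.
  move=> cardA neAS; have -> : pi A / e = pi A / pi S * (pi S / e).
    by rewrite mulrA divfK.
  by apply: (videalMr hG wv) => //; exact: subset_prod_dominated.
have Orho A : #|A| = #|S| -> pi A / e \in O.
  move=> cardA; have [->//|neAS] := eqVneq A S.
  by apply: (videalW hG wv); exact: Mrho.
pose q := \prod_(A : {set 'I_n} | #|A| == #|S|) ('X - (pi A / e)%:P).
pose q1 := \prod_(A : {set 'I_n} | (#|A| == #|S|) && (A != S)) ('X - (pi A / e)%:P).
have eq_q : q = ('X - (pi S / e)%:P) * q1 by rewrite /q (bigD1 S).
have Oq1 : q1 \is a polyOver O.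
  by apply: rpred_prod => A /andP[/eqP cardA _]; rewrite polyOverXsubC Orho.
have Oq : q \is a polyOver O by rewrite eq_q rpredM // polyOverXsubC.
have Eq : q \is a polyOver 'E.
  (* [q] descends to $E$: substitute $eT$ in the polynomial with roots $\pi(A)$ and divide each
     factor by $e$. *)
  have -> : q = \prod_(A : {set 'I_n} | #|A| == #|S|)
      (e^-1%:P * (('X - (pi A)%:P) \Po (e *: 'X))).
    apply: eq_bigr => A _; rewrite comp_polyB comp_polyX comp_polyC mulrBr.
    by rewrite mul_polyC scalerA mulVf // scale1r -polyCM mulrC.
  rewrite big_split rpredM //.
    by apply: rpred_prod => A _; rewrite polyOverC rpredV.
  rewrite -(rmorph_prod (comp_poly (e *: 'X))) polyOver_comp //.
    exact: prod_subset_XsubC_over.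
  by rewrite polyOverZ ?polyOverX.
have nq1 : q1.[1] \notin M.
  rewrite horner_prod; elim/big_ind: _ => [|x y|A /andP[/eqP cardA neAS]].
  - exact: videal1 wv.
  - exact: (videal_prime hG wv).
  rewrite hornerXsubC; apply: (videal_addNr hG wv); first exact: videal1 wv.
  by rewrite (videalN hG wv) Mrho.
have O1 : 1 \in O by exact: rpred1.
have [|||a [Ea ra Ma]] := (henselianP hG wv hE).1 hensE q 1 Eq Oq _ O1.
- exact: rpred1.
- rewrite eq_q hornerM hornerXsubC (videalMr hG wv) ?rpred_horner //.
  by rewrite -(videalN hG wv) opprB.
- rewrite eq_q derivM derivXsubC mul1r hornerD hornerM hornerXsubC.
  apply: (videal_addNr hG wv) => //; apply: (videalMr hG wv).
    by rewrite -(videalN hG wv) opprB.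
  by rewrite rpred_horner ?polyOver_deriv.
suff eq_a : a = pi S / e by rewrite -[pi S](divfK e0) rpredM // -eq_a.
(* The root $a$ is some $\pi(A)/e$; for $A \ne S$, both $a$ and $a - 1$ would lie in $M$. *)
have /eqP := rootP ra; rewrite horner_prod prodf_seq_eq0 => /hasP[A _ /andP[/eqP cardA]].
rewrite hornerXsubC subr_eq0 => /eqP eq_a; suff eqAS : A = S by rewrite eq_a eqAS.
apply/eqP; apply: contraT => neAS; case/negP: (videal1 wv).
rewrite -[1](subKr a); apply: (videalB hG wv) => //.
by rewrite eq_a; exact: Mrho.
Qed.

Lemma separated_factor_over : \prod_(i in S) ('X - (r i)%:P) \is a polyOver 'E.
Proof.
have EpiS := dominant_subset_prod_in.
pose q1 := \prod_(A : {set 'I_n} | (#|A| == #|S|) && (A != S)) ('X - (pi A)%:P).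
(* Strictly least value separates the node $\pi(S)$ from the others, which may coincide among
   themselves. *)
have q1_neq0 : q1.[pi S] != 0.
  rewrite horner_prod prodf_seq_neq0; apply/allP => A _.
  apply/implyP => /andP[/eqP cardA neAS]; rewrite hornerXsubC subr_eq0.
  apply/negP => /eqP eq_pi; have := subset_prod_dominated cardA neAS.
  by rewrite -eq_pi divff // (negPf (videal1 wv)).
(* This value is the derivative at $\pi(S)$ of the product over all subsets, which is over $E$. *)
have Eq1 : q1.[pi S] \in 'E.
  suff <- : (\prod_(A : {set 'I_n} | #|A| == #|S|) ('X - (pi A)%:P))^`().[pi S]
      = q1.[pi S].
    rewrite rpred_horner // polyOver_deriv //; exact: prod_subset_XsubC_over.
  rewrite (bigD1 S) //= derivM derivXsubC mul1r hornerD hornerM hornerXsubC.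
  by rewrite subrr mul0r addr0.
apply/polyOverP => j.
rewrite -[_`_j](mulfK q1_neq0) rpred_div //.
have Ej := lagrange_subset_over Er #|S| j; set p := \sum_(A | _) _ in Ej.
suff <- : p.[pi S] = (\prod_(i in S) ('X - (r i)%:P))`_j * q1.[pi S].
  by rewrite rpred_horner.
rewrite horner_sum (bigD1 S) //= hornerZ [X in _ + X]big1 ?addr0 //.
move=> A /andP[cardA neAS].
rewrite hornerZ (bigD1 S) /=; last by rewrite eqxx eq_sym.
by rewrite hornerM hornerXsubC subrr mul0r mulr0.
Qed.

End SeparatedFactor.
Lemma exists_minimal_value (b : F) (rs : seq F) : b != 0 -> b \in rs ->
  exists2 m, m \in rs & m != 0 /\ forall x, x \in rs -> x / m \in O.
Proof.
(* Keeping [b] in front provides a nonzero candidate throughout the induction. *)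
move=> b0; suff [m rs_m [m0 min_m]] : exists2 m, m \in b :: rs &
    m != 0 /\ forall x, x \in b :: rs -> x / m \in O.
  move=> rs_b; exists m; first by move: rs_m; rewrite inE => /predU1P[->|].
  by split=> // x rs_x; apply: min_m; rewrite inE rs_x orbT.
elim: rs => [|y rs [m rs_m [m0 min_m]]].
  exists b; rewrite ?inE // b0; split=> // x; rewrite inE => /eqP ->.
  by rewrite divff // rpred1.
have sub x : x \in [:: b, y & rs] -> x = y \/ x \in b :: rs.
  by rewrite !inE => /or3P[-> | /eqP -> | ->]; rewrite ?orbT; auto.
have [Oy|nOy] := boolP (y / m \in O).
  exists m; first by move: rs_m; rewrite !inE => /orP[->|->]; rewrite ?orbT.
  by split=> // x /sub[->|/min_m].
have Oym := videalW hG wv (vring_notinV nOy); rewrite invf_div in Oym.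
have y0 : y != 0 by apply: contraNneq nOy => ->; rewrite mul0r rpred0.
exists y; first by rewrite !inE eqxx orbT.
split=> // x /sub[->|/min_m Ox]; first by rewrite divff // rpred1.
by rewrite -[x](divfK m0) -[_ / y]mulrA rpredM.
Qed.

(** The roots of minimal value give a nonconstant factor over $E$, which irreducibility makes all of
    [mu]. Exchanging $a$ and $b$ shows that nonzero roots have equal value. *)
Lemma minimal_polynomial_root_ratio x mu a b :
    minimal_polynomial 'E x mu -> root mu a -> root mu b -> b != 0 ->
  a / b \in O.
Proof.
move=> mu_min ra rb b0; have [monmu Emu rmu _] := mu_min.
have [rs eq_mu] := closed_field_poly_normal mu.
rewrite (monicP monmu) scale1r in eq_mu.
pose n := size rs; pose r (i : 'I_n) := rs`_i.
have eq_r : mu = \prod_(i < n) ('X - (r i)%:P) by rewrite eq_mu (big_nth 0) big_mkord.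
have rootr c : root mu c -> exists i, c = r i.
  rewrite eq_mu root_prod_XsubC => /(nthP 0)[i lt_i <-].
  by exists (Ordinal lt_i).
have [ia eq_a] := rootr _ ra; have [ib eq_b] := rootr _ rb.
have [i0 ri0 O_r] : exists2 i0, r i0 != 0 & forall i, r i / r i0 \in O.
  have rs_b : b \in rs by rewrite -root_prod_XsubC -eq_mu.
  have [m rs_m [m0 min_m]] := exists_minimal_value b0 rs_b.
  case/(nthP 0): rs_m => i lt_i eq_m; exists (Ordinal lt_i); rewrite /r /= eq_m //.
  by move=> j; apply: min_m; exact: mem_nth.
pose S := [set i | r i / r i0 \notin M]%SET.
have S_r i : (i \in S) = (r i / r i0 \notin M) by rewrite inE.
have Er : \prod_(i < n) ('X - (r i)%:P) \is a polyOver 'E by rewrite -eq_r.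
pose D := \prod_(i in S) ('X - (r i)%:P).
have ED : D \is a polyOver 'E := separated_factor_over Er ri0 O_r S_r.
have monD : D \is monic by apply: monic_prod => i _; exact: monicXsubC.
have dvdD : D %| mu by rewrite eq_r (bigID (mem S)) /= dvdp_mulIl.
have szD : size D = #|S|.+1.
  by rewrite /D -big_enum /= size_prod_XsubC -cardE.
have S_i0 : i0 \in S by rewrite S_r divff // (videal1 wv).
have S_all i : i \in S.
  have [/eqP|/eqP] := minimal_polynomial_factor mu_min monD ED dvdD.
    by rewrite szD eqSS cards_eq0 => /eqP S0; rewrite S0 inE in S_i0.
  rewrite szD eq_mu size_prod_XsubC eqSS -/n -[X in _ == X]card_ord -cardsT.
  move=> cardS; suff -> : S = [set: 'I_n]%SET by rewrite inE.
  by apply/eqP; rewrite eqEcard finset.subsetT (eqP cardS) leqnn.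
have := S_all ib; rewrite S_r => /(vringV hG wv) Ob.
rewrite eq_a eq_b; have -> : r ia / r ib = r ia / r i0 * (r ib / r i0)^-1.
  by rewrite invf_div mulrA divfK.
exact: rpredM.
Qed.

End ConjugateValues.

(** * Simple extensions of henselian fields *)

Section SubringType.
Variables (F : fieldType) (S : subringClosed F).

(** [integralOver] is relative to a ring morphism; making the subring a ring of its own turns its
    inclusion [val] into one. *)
Record subring_elt := SubringElt { subring_val : F; _ : subring_val \in S }.

HB.instance Definition _ := [isSub for subring_val].
HB.instance Definition _ := [Choice of subring_elt by <:].
HB.instance Definition _ := [SubChoice_isSubComNzRing of subring_elt by <:].

Lemma polyOver_subringP (q : {poly F}) : q \is a polyOver S ->
  exists p : {poly subring_elt}, map_poly val p = q.
Proof.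
move=> Sq; exists (\poly_(i < size q) insubd 0 q`_i).
apply/polyP => i; rewrite coef_map coef_poly.
case: ltnP => [_|le_qi]; last by rewrite [RHS]nth_default.
by rewrite /= val_insubd (polyOverP Sq).
Qed.

Lemma integral_subringP (y : F) :
  integralOver (val : subring_elt -> F) y <->
  exists q, [/\ q \is monic, q \is a polyOver S & root q y].
Proof.
split=> [[p monp rp]|[q [monq Sq rq]]].
  exists (map_poly val p); split=> //; first by rewrite monic_map.
  by apply/polyOverP => i; rewrite coef_map /= (valP p`_i).
have [p eq_p] := polyOver_subringP Sq.
exists p; last by rewrite eq_p.
apply/monicP/val_inj; rewrite -lead_coef_map_inj ?eq_p ?(monicP monq) //.
exact: val_inj.
Qed.

(** Integrality is transitive: the coefficients of $q$ are polynomials in the integral element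
    $X$. *)
Lemma integral_adjoin_trans (X y : F) (g q : {poly F}) :
    g \is monic -> g \is a polyOver S -> root g X ->
    q \is monic -> (forall i, exists2 p, p \is a polyOver S & q`_i = p.[X]) ->
    root q y ->
  exists h, [/\ h \is monic, h \is a polyOver S & root h y].
Proof.
move=> mong Sg rg monq Eq rq; apply/integral_subringP.
apply: (integral_root_monic monq rq) => c /(nthP 0)[i _ <-].
have [p Sp ->] := Eq i.
apply: integral_horner; last by apply/integral_subringP; exists g.
move=> d /(nthP 0)[j _ <-]; apply/integral_subringP.
exists ('X - (p`_j)%:P); rewrite monicXsubC root_XsubC eqxx polyOverXsubC.
by rewrite (polyOverP Sp).
Qed.

End SubringType.

Section SimpleExtension.
Variables (F : fieldType) (E : set F) (hE : is_subfield E) (X : F).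
Local Notation "'E" := (subfield_pred hE).

(** This is the ring $E[X]$, which is the field $E(X)$ once $X$ is algebraic over $E$. *)
Definition simple_extension : set F :=
  [set y | exists2 p, p \is a polyOver 'E & y = p.[X]].

Lemma simple_extension_base c : E c -> simple_extension c.
Proof.
by move=> Ec; exists c%:P; rewrite ?hornerC // polyOverC; apply/subfield_predP.
Qed.

Lemma simple_extension_gen : simple_extension X.
Proof. by exists 'X; rewrite ?hornerX // polyOverX. Qed.

Lemma simple_extension_min L : is_subfield L -> E `<=` L -> L X ->
  simple_extension `<=` L.
Proof.
move=> hL EL LX y [p Ep ->]; apply/(subfield_predP hL).
apply: rpred_horner; last exact/subfield_predP.
apply/polyOverP => i; apply/subfield_predP/EL/(subfield_predP hE).
exact: (polyOverP Ep).
Qed.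

Variable g : {poly F}.
Hypotheses (mong : g \is monic) (Eg : g \is a polyOver 'E) (rg : root g X).

(** If $\nu = QT + c$ is the minimal polynomial of $a \ne 0$, then $c \ne 0$ by minimality and
    $a^{-1} = -c^{-1}Q(a)$. *)
Lemma simple_extension_inv a : simple_extension a -> simple_extension a^-1.
Proof.
move=> [p Ep eq_a]; have [a0|a0] := eqVneq a 0.
  by rewrite a0 invr0 -a0 eq_a; exists p.
have [h [monh Eh rh]] : exists h, [/\ h \is monic, h \is a polyOver 'E & root h a].
  (* Since $a = p(X)$, the polynomial $T - a$ has its coefficients in $E[X]$. *)
  apply: (integral_adjoin_trans mong Eg rg (monicXsubC a)).
    move=> i; rewrite coefB coefX coefC.
    exists ((i == 1)%N%:R%:P - (if i == 0%N then p else 0)).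
      by rewrite rpredB ?polyOverC ?rpred_nat //; case: ifP => // _; rewrite rpred0.
    by rewrite hornerD hornerN hornerC; case: ifP => _; rewrite -?eq_a ?horner0.
  by rewrite root_XsubC.
have [nu nu_min] := minimal_polynomial_exists Eh (monic_neq0 monh) rh.
have [monnu Enu rnu _] := nu_min.
have [Q EQ eq_nu] := polyOver_horner_diff Enu (rpred0 'E).
rewrite subr0 in eq_nu; set c := nu.[0] in eq_nu.
have c0 : c != 0.
  apply/eqP => c0; rewrite c0 addr0 in eq_nu.
  have nu0 := monic_neq0 monnu.
  have Q0 : Q != 0 by apply: contraNneq nu0 => Q0; rewrite eq_nu Q0 mul0r.
  have rQ : root Q a by move: rnu; rewrite eq_nu rootM rootX (negPf a0) orbF.
  have := minimal_polynomial_leq nu_min EQ Q0 rQ.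
  by rewrite eq_nu size_mulX // ltnn.
have Ec : c \in 'E by rewrite rpred_horner ?rpred0.
exists (- c^-1 *: (Q \Po p)).
  by rewrite polyOverZ ?polyOver_comp // rpredN rpredV.
rewrite hornerZ horner_comp -eq_a; have /eqP := rootP rnu.
rewrite eq_nu hornerD hornerMX hornerC addr_eq0 => /eqP eqQ.
by apply: (mulIf a0); rewrite -mulrA eqQ mulrNN !mulVf.
Qed.

Lemma simple_extension_subfield : is_subfield simple_extension.
Proof.
have EM x y : simple_extension x -> simple_extension y -> simple_extension (x * y).
  by move=> [p Ep ->] [q Eq ->]; exists (p * q); rewrite ?hornerM // rpredM.
apply: is_subfieldP => [|x y [p Ep ->] [q Eq ->]|x y Ex Ey].
- by exists 1; rewrite ?hornerC // rpred1.
- by exists (p - q); rewrite ?hornerD ?hornerN // rpredB.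
- by apply: EM => //; exact: simple_extension_inv.
Qed.

End SimpleExtension.

Section HenselianExtension.
Variables (G : porderZmodType) (hG : ordered_abelian_group G).
Variables (F : closedFieldType) (w : F -> option G) (wv : valuation w).
Variables (E : set F) (hE : is_subfield E) (hensE : henselian w E).
Local Notation O := (vring hG wv).
Local Notation M := (videal w).
Local Notation "'E" := (subfield_pred hE).
Variables (X : F) (g : {poly F}).
Hypotheses (mong : g \is monic) (Eg : g \is a polyOver 'E) (rg : root g X).
Let hEX := simple_extension_subfield mong Eg rg.
Local Notation "'EX" := (subfield_pred hEX).

Let sub_EX q : q \is a polyOver 'E -> q \is a polyOver 'EX.
Proof.
move=> Eq; apply/polyOverP => i; apply/subfield_predP/simple_extension_base.
exact/(subfield_predP hE)/(polyOverP Eq).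
Qed.

(** Let $a$ be the root near $b$ in the algebraic closure and $m$ its minimal polynomial over
    $E(X)$. For a root $c$ of $m$, $c - b$ is conjugate to $a - b$ over $E$, hence lies in $M$, so
    $c = a$ by uniqueness. As $a$ is a simple root of $q$, $m = T - a$. *)
Lemma simple_extension_henselian : henselian w (simple_extension hE X).
Proof.
apply/(henselianP hG wv hEX) => q b Eq Oq Eb Ob qb dqb.
have [a ra Ma] := closed_hensel Oq qb dqb.
exists a; split=> //.
have Oq' : q^`() \is a polyOver O by exact: polyOver_deriv.
have [<-//|nab] := eqVneq b a; have ab0 : a - b != 0 by rewrite subr_eq0 eq_sym.
have q0 : q != 0.
  by apply: contraNneq dqb => ->; rewrite deriv0 horner0 (videal0 wv).
have [m m_min] := minimal_polynomial_exists Eq q0 ra.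
have [monm Em rm min_m] := m_min.
have [h [monh Eh rh]] : exists h, [/\ h \is monic, h \is a polyOver 'E & root h (a - b)].
  (* $m(T + b)$ is monic over $E(X)$ and vanishes at $a - b$. *)
  apply: (@integral_adjoin_trans _ _ X _ g (m \Po ('X + b%:P))) => //.
  - rewrite monicE lead_coef_comp ?size_XaddC //.
    rewrite (monicP monm) lead_coefDl ?size_polyX ?size_polyC; last by case: eqP.
    by rewrite lead_coefX expr1n mul1r.
  - move=> i; apply/(subfield_predP hEX)/polyOverP.
    by rewrite polyOver_comp // polyOverXaddC.
  - by rewrite rootE horner_comp hornerD hornerX hornerC subrK; exact: rm.
have [nu nu_min] := minimal_polynomial_exists Eh (monic_neq0 monh) rh.
have [monnu Enu rnu _] := nu_min.
have m_nu : m %| nu \Po ('X - b%:P).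
  apply: min_m; last by rewrite rootE horner_comp hornerXsubC.
  by rewrite polyOver_comp ?polyOverXsubC //; exact: sub_EX.
have uniq_root c : root m c -> c = a.
  move=> rmc; have rc : root q c by exact: root_dvdp (min_m _ Eq ra) rmc.
  apply/esym/(hensel_root_unique Oq Ob dqb ra Ma rc).
  have rnuc : root nu (c - b).
    by have := root_dvdp m_nu rmc; rewrite rootE horner_comp hornerXsubC.
  have := minimal_polynomial_root_ratio hG wv hensE nu_min rnuc rnu ab0.
  by move=> Oc; rewrite -[c - b](divfK ab0) (videalMl hG wv).
have [Q eq_m] := factor_theorem m a rm.
have [sQ|sQ] := eqVneq (size Q) 1%N.
  have /size_poly1P[k k0 eq_Q] : size Q == 1%N by apply/eqP.
  have := monicP monm; rewrite eq_m lead_coefM lead_coefXsubC mulr1 eq_Q lead_coefC.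
  move=> k1; rewrite eq_m eq_Q k1 mul1r in Em.
  by rewrite -polyOverXsubC.
have [c rc] := closed_rootP Q sQ.
have ca : c = a by apply: uniq_root; rewrite eq_m rootM rc.
case/negP: (videal_neq0 wv (hornerNvideal_near Oq' Ob dqb Ma)).
have [R eq_q] := dvdpP _ _ (min_m _ Eq ra).
rewrite eq_q eq_m mulrA derivM derivXsubC mulr1 hornerD hornerM hornerXsubC.
by rewrite subrr mulr0 add0r hornerM -ca (rootP rc) mulr0.
Qed.

End HenselianExtension.

(** * Relative approximation degree *)

Section DominantMonomial.
Variables (G : porderZmodType) (hG : ordered_abelian_group G).
Variables (F : fieldType) (w : F -> option G) (wv : valuation w).
Variables (d : Order.disp_t) (I : orderType d) (u : I -> F).
Hypothesis I_unbounded : forall i : I, exists j : I, (i < j)%O.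
Hypothesis I_inhabited : exists i : I, True.
Hypothesis u_neq0 : forall i, u i != 0.
Hypothesis u_increasing : forall i j, (i < j)%O -> u j / u i \in videal w.
Local Notation O := (vring hG wv).
Local Notation M := (videal w).

(* Kaplansky: two monomials c_h u^h and c_i u^i can only exchange dominance
   once along u, in favour of the one of smaller degree. *)
Lemma dominant_monomial (c : nat -> F) (N : nat) :
    (exists2 i, (0 < i <= N)%N & c i != 0) ->
  exists h i0, [/\ (0 < h <= N)%N, c h != 0 & forall nu, (i0 < nu)%O ->
    forall i, (0 < i <= N)%N -> i != h ->
      (c i * u nu ^+ i) / (c h * u nu ^+ h) \in M].
Proof.
have range_S i n : (0 < i <= n.+1)%N -> i != n.+1 -> (0 < i <= n)%N.
  by move=> /andP[-> le_i] ne_i; rewrite -ltnS ltn_neqAle ne_i.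
elim: N => [|N IHN] [i le_iN ci]; first by case: i le_iN {ci} => [|i]; rewrite ?andbF.
have [no_low|] := pselect (forall k, (0 < k <= N)%N -> c k = 0).
  have [i0 _] := I_inhabited; exists N.+1, i0; split; first exact: leqnn.
    have [eq_i|ne_i] := eqVneq i N.+1; first by rewrite -eq_i.
    by rewrite (no_low i (range_S _ _ le_iN ne_i)) eqxx in ci.
  move=> nu _ k /range_S/[apply] /no_low ->; rewrite !mul0r; exact: videal0 wv.
move=> /existsNP[k /not_implyP[le_kN /eqP ck]].
have [|h [i0 [/andP[h0 le_hN] ch dom]]] := IHN; first by exists k.
have [cN0|cN] := eqVneq (c N.+1) 0.
  exists h, i0; split=> //; first by rewrite h0 ltnW.
  move=> nu lt_nu j le_j ne_j; have [->|ne_jN] := eqVneq j N.+1.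
    rewrite cN0 !mul0r; exact: videal0 wv.
  by apply: dom => //; exact: range_S.
(* [rho] compares the new top monomial with the one dominant in lower degrees; its value strictly
   increases along [u]. *)
pose rho nu := c N.+1 * u nu ^+ N.+1 / (c h * u nu ^+ h).
have lt_hN : (h < N.+1)%N by [].
have rho_neq0 nu : rho nu != 0.
  by rewrite !mulf_neq0 ?invr_neq0 ?mulf_neq0 ?expf_neq0.
have rhoE nu nu' : rho nu' = rho nu * (u nu' / u nu) ^+ (N.+1 - h).
  have rE x : x != 0 ->
      c N.+1 * x ^+ N.+1 / (c h * x ^+ h) = c N.+1 / c h * x ^+ (N.+1 - h).
    move=> x0; have -> : x ^+ N.+1 = x ^+ (N.+1 - h) * x ^+ h.
      by rewrite -exprD subnK // ltnW.
    by rewrite mulrA -mulf_div divff ?expf_neq0 // mulr1 mulrAC.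
  rewrite /rho !rE // -[RHS]mulrA; congr (_ * _).
  by rewrite expr_div_n mulrCA divff ?mulr1 // expf_neq0.
have Mpow nu nu' : (nu < nu')%O -> (u nu' / u nu) ^+ (N.+1 - h) \in M.
  move=> lt_nu; rewrite -(prednK (_ : 0 < N.+1 - h)%N) ?subn_gt0 // exprS.
  apply: (videalMr hG wv); first exact: u_increasing.
  by rewrite rpredX // (videalW hG wv) // u_increasing.
(* Once in $M$, [rho] stays there and [h] keeps dominating. Otherwise $1/\rho$ is always integral,
   and comparison with a later index puts it in $M$, so degree [N.+1] takes over. *)
have [[nu1 Mrho]|noM] := pselect (exists nu, rho nu \in M).
  exists h, (Order.max i0 nu1); split=> //; first by rewrite h0 ltnW.
  move=> nu; rewrite gt_max => /andP[lt0 lt1] j le_j ne_j.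
  have [->|ne_jN] := eqVneq j N.+1; last by apply: dom => //; exact: range_S.
  rewrite -[_ / _]/(rho nu) (rhoE nu1).
  by apply: (videalMr hG wv) => //; apply: (videalW hG wv); exact: Mpow.
exists N.+1, i0; split=> [||nu lt_nu]; [exact: leqnn|by []|].
move=> j le_j ne_j.
have Mrho : (rho nu)^-1 \in M.
  have [nu' lt_nu'] := I_unbounded nu.
  have -> : (rho nu)^-1 = (rho nu')^-1 * (u nu' / u nu) ^+ (N.+1 - h).
    have invM x y : y != 0 -> x^-1 = (x * y)^-1 * y :> F.
      by move=> y0; rewrite invfM divfK.
    by rewrite (rhoE nu nu'); apply: invM; rewrite expf_neq0 // mulf_neq0 ?invr_neq0.
  apply: (videalMl hG wv); last exact: Mpow.
  by apply: (vringV hG wv); apply/negP => Mr; apply: noM; exists nu'.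
have [->|ne_jh] := eqVneq j h.
  by move: Mrho; rewrite invf_div.
have -> : c j * u nu ^+ j / (c N.+1 * u nu ^+ N.+1) =
    (c j * u nu ^+ j / (c h * u nu ^+ h)) * (rho nu)^-1.
  by rewrite invf_div mulrA divfK // mulf_neq0 // expf_neq0.
apply: (videalMr hG wv); last exact: (videalW hG wv).
by apply: dom => //; exact: range_S.
Qed.

End DominantMonomial.

(** * Pseudo-limits and Taylor expansions *)

Section PseudoLimit.
Variables (G : porderZmodType) (hG : ordered_abelian_group G).
Variables (K F : fieldType) (iota : {rmorphism K -> F}).
Variables (v : K -> option G) (w : F -> option G).
Hypotheses (vv : valuation v) (wv : valuation w).
Hypothesis w_extends_v : forall a, w (iota a) = v a.
Variables (d : Order.disp_t) (I : orderType d) (z : I -> K) (X : F).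
Hypotheses (I_limit : limit_ordinal I) (z_pc : pseudo_convergent v z).
Hypothesis X_limit : is_pseudo_limit v w iota z X.

Lemma limit_ordinal_succ (i : I) : exists j, is_succ i j.
Proof.
have [wo _ unb] := I_limit; have [j0 lt_ij0] := unb i.
have [|j [[lt_ij min_j] _]] := wo (fun j => (i < j)%O); first by exists j0.
exists j; split=> // k lt_ik; exact: min_j.
Qed.

(** The gap $\gamma_i$ is strictly below the next one, so it is not infinite. *)
Lemma pseudo_limit_gap_neq0 i : X - iota (z i) != 0.
Proof.
have [j ij] := limit_ordinal_succ i; have [k jk] := limit_ordinal_succ j.
apply: contraTneq (z_pc ij.1 jk.1) => X0.
by rewrite -(X_limit ij) X0 (val0 wv) /vlt; case: (v _).
Qed.

Lemma pseudo_limit_gap_increasing i k : (i < k)%O ->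
  (X - iota (z k)) / (X - iota (z i)) \in videal w.
Proof.
move=> lt_ik; have [j ij] := limit_ordinal_succ i.
have [l kl] := limit_ordinal_succ k.
rewrite -(vltE hG wv) ?pseudo_limit_gap_neq0 //.
rewrite (X_limit ij) (X_limit kl).
have := ij.2 _ lt_ik; rewrite le_eqVlt => /predU1P[->|lt_jk].
  by apply: z_pc => //; exact: kl.1.
(* The ultrametric inequality replaces the successor $j$ of $i$ by $k$, as $v(z_j - z_k) > v(z_i -
   z_j)$. *)
have -> : v (z i - z j) = v (z i - z k).
  have lt_v := z_pc ij.1 lt_jk.
  have n0 : z i - z j != 0.
    by apply: contraTneq lt_v => ->; rewrite (val0 vv) /vlt; case: (v _).
  rewrite (vltE hG vv _ n0) in lt_v.
  have nM : 1 + (z j - z k) / (z i - z j) \notin videal v.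
    by apply: (videal_addNr hG vv) => //; exact: videal1 vv.
  have eq_r : (z i - z k) / (z i - z j) = 1 + (z j - z k) / (z i - z j).
    by rewrite -[in LHS](subrKA (z j)) mulrDl divff.
  apply/esym/(val_eq hG vv); rewrite eq_r // rpredD ?rpred1 //.
  exact: (videalW hG vv).
by apply: z_pc => //; exact: kl.1.
Qed.

(** Two affine expressions in $w(X - z_\nu)$ agreeing at two indices have equal slopes, because this
    value strictly increases. *)
Lemma approximation_degree_unique f h1 h2 :
    is_approximation_degree v w iota z X f h1 ->
    is_approximation_degree v w iota z X f h2 -> h1 = h2.
Proof.
wlog suff lt_absurd : h1 h2 / (h1 < h2)%N ->
    is_approximation_degree v w iota z X f h1 ->
    is_approximation_degree v w iota z X f h2 -> False.
  move=> d1 d2; have [lt12|lt21|//] := ltngtP h1 h2.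
    by case: (lt_absurd _ _ lt12 d1 d2).
  by case: (lt_absurd _ _ lt21 d2 d1).
move=> lt12 [_ [i1 [b1 [_ eq1]]]] [_ [i2 [b2 [_ eq2]]]].
have [_ _ unb] := I_limit; have [i lt_i] := unb (Order.max i1 i2).
have [k lt_ik] := unb i.
have lt_k := lt_trans lt_i lt_ik; rewrite !gt_max in lt_i lt_k.
have [/andP[lt_i1 lt_i2] /andP[lt_k1 lt_k2]] := (lt_i, lt_k).
have [a wa] := val_neq0 wv (pseudo_limit_gap_neq0 i).
have [b wb] := val_neq0 wv (pseudo_limit_gap_neq0 k).
have lt_ab : a < b.
  have := pseudo_limit_gap_increasing lt_ik.
  by rewrite -(vltE hG wv) ?pseudo_limit_gap_neq0 // wa wb /vlt /= lt_neqAle.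
have := eq1 i lt_i1; rewrite (eq2 i lt_i2) wa /= => -[eqi].
have := eq1 k lt_k1; rewrite (eq2 k lt_k2) wb /= => -[eqk].
have eqn (x : G) : b2 + x *+ h2 = b1 + x *+ h1 -> x *+ (h2 - h1) = b1 - b2.
  move=> eqx; apply: (addIr (x *+ h1)); rewrite -mulrnDr subnK 1?ltnW //.
  by apply: (addrI b2); rewrite eqx addrA addrA [b2 + b1]addrC addrK.
have ba0 : 0 < (b - a) *+ (h2 - h1).
  by apply: oag_mulrn_gt0; rewrite ?subn_gt0 // -[0](subrr a) (oag_ltD2r hG).
by move: ba0; rewrite mulrnBl (eqn _ eqi) (eqn _ eqk) subrr ltxx.
Qed.

Lemma nderivn_lead (p : {poly F}) x :
  p^`N((size p).-1).[x] = lead_coef p.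
Proof.
have -> : p^`N((size p).-1) = (lead_coef p)%:P; last by rewrite hornerC.
apply/polyP => i; rewrite coef_nderivn coefC; case: i => [|i] /=.
  by rewrite addn0 binn mulr1n.
rewrite nth_default ?mul0rn // addnS -addSn.
by apply: leq_trans (leq_addr _ _); exact: leqSpred.
Qed.

(** Taylor coefficients are Hasse derivatives, free of division by factorials; the top one is the
    leading coefficient, so some coefficient of positive degree is nonzero. *)
Lemma dominant_taylor_term (p : {poly F}) : (1 < size p)%N ->
  exists h i0, [/\ (0 < h)%N, p^`N(h).[X] != 0 & forall nu, (i0 < nu)%O ->
    forall i, (0 < i)%N -> i != h ->
      (p^`N(i).[X] * (iota (z nu) - X) ^+ i) /
      (p^`N(h).[X] * (iota (z nu) - X) ^+ h) \in videal w].
Proof.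
move=> sp; have [wo [i00 _] unb] := I_limit.
have [||||h [i0 [/andP[h0 _] ch dom]]] :=
    @dominant_monomial G hG F w wv d I (fun nu => iota (z nu) - X) unb _ _ _
    (fun i => p^`N(i).[X]) (size p).-1.
- by exists i00.
- by move=> nu; rewrite -opprB oppr_eq0 pseudo_limit_gap_neq0.
- move=> i j lt_ij; rewrite -(opprB X) -[_ - X]opprB invrN mulrNN.
  exact: pseudo_limit_gap_increasing.
- exists (size p).-1; last by rewrite nderivn_lead lead_coef_eq0 -size_poly_gt0 ltnW.
  by rewrite leqnn andbT -ltnS prednK // ltnW.
exists h, i0; split=> // nu lt_nu i i_gt0 ne_ih.
have [le_i|lt_i] := leqP i (size p).-1; first by apply: dom; rewrite ?i_gt0.
rewrite nderivn_poly0 ?horner0 ?mul0r ?(videal0 wv) //.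
by apply: leq_trans lt_i; exact: leqSpred.
Qed.

Lemma taylor_value (p : {poly F}) h nu : (0 < h)%N -> p^`N(h).[X] != 0 ->
    (forall i, (0 < i)%N -> i != h ->
      (p^`N(i).[X] * (iota (z nu) - X) ^+ i) /
      (p^`N(h).[X] * (iota (z nu) - X) ^+ h) \in videal w) ->
  w (p.[X] - p.[iota (z nu)]) = w (p^`N(h).[X] * (iota (z nu) - X) ^+ h).
Proof.
move=> h0 ch dom; have u0 : iota (z nu) - X != 0.
  by rewrite -opprB oppr_eq0 pseudo_limit_gap_neq0.
set t := p^`N(h).[X] * _; have t0 : t != 0 by rewrite mulf_neq0 ?expf_neq0.
rewrite -(valN hG wv) opprB.
have Mr : (p.[iota (z nu)] - p.[X]) / t - 1 \in videal w.
  have -> : iota (z nu) = X + (iota (z nu) - X) by rewrite addrC subrK.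
  (* The sum is taken long enough to contain the term of degree [h]; splitting off degree $0$ then
     shifts that term to index [h.-1]. *)
  rewrite (nderiv_taylor_wide (n := (maxn (size p) h).+1)); last 2 first.
  - exact: mulrC.
  - by rewrite ltnW // ltnS leq_maxl.
  rewrite big_ord_recl /= expr0 mulr1 nderivn0 addrAC subrr add0r.
  have lt_h : (h.-1 < maxn (size p) h)%N.
    by rewrite prednK // leq_maxr.
  rewrite (bigD1 (Ordinal lt_h)) //= /bump add1n prednK // -/t mulrDl divff //.
  rewrite addrAC subrr add0r mulr_suml; apply: (videal_sum hG wv) => i ne_i.
  apply: dom => //; apply: contra ne_i => /eqP eq_i.
  by apply/eqP/val_inj; exact: (congr1 predn eq_i).
have nM : (p.[iota (z nu)] - p.[X]) / t \notin videal w.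
  rewrite -[_ / t](subrK 1) addrC.
  by apply: (videal_addNr hG wv) => //; exact: videal1 wv.
apply: (val_eq hG wv) => //.
by rewrite -[_ / t](subrK 1) rpredD ?rpred1 // (videalW hG wv).
Qed.

Hypothesis KX_immediate : immediate w (range iota) (adjoin iota X).

(** Here $\beta$ is the value of the $h$-th Taylor coefficient, an element of $K(X)$; immediacy puts
    it in $vK$. *)
Lemma approximation_degree_taylor f h i0 : (0 < h)%N ->
    let p := map_poly iota f in p^`N(h).[X] != 0 ->
    (forall nu, (i0 < nu)%O -> forall i, (0 < i)%N -> i != h ->
      (p^`N(i).[X] * (iota (z nu) - X) ^+ i) /
      (p^`N(h).[X] * (iota (z nu) - X) ^+ h) \in videal w) ->
  approximation_degree v w iota z X f = h.
Proof.
move=> h0 p ch dom.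
suff deg_h : is_approximation_degree v w iota z X f h.
  by apply: xget_unique => // k deg_k; exact: approximation_degree_unique deg_k deg_h.
split=> //; have [b wb] := val_neq0 wv ch; exists i0, b; split.
  have : value_group w (adjoin iota X) b.
    exists p^`N(h).[X] => //; apply/(subfield_predP (adjoin_subfield iota X)).
    apply: rpred_horner; last by apply/subfield_predP; exact: adjoin_gen.
    apply: polyOver_nderivn; apply/polyOverP => i; rewrite coef_map /=.
    by apply/subfield_predP; exact: adjoin_base.
  by rewrite KX_immediate.1 => -[_ [a _ <-] wa]; exists a; rewrite // -w_extends_v.
move=> nu lt_nu; rewrite -horner_map (taylor_value h0 ch (dom nu lt_nu)).
have [c wc] := val_neq0 wv (pseudo_limit_gap_neq0 nu).
have wu : w (iota (z nu) - X) = Some c by rewrite -(valN hG wv) opprB.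
by rewrite (valuationM wv) wb wc (valX wv h wu).
Qed.

End PseudoLimit.

(** * The degree bound *)

(** The powers $X^i$ with $i < \deg\mu$ form a basis: remainders modulo $\mu$ give existence of
    coordinates, minimality gives uniqueness. *)
Lemma extension_degree_simple (F : fieldType) (E : set F) (hE : is_subfield E)
    (X : F) (mu : {poly F}) :
    minimal_polynomial (subfield_pred hE) X mu ->
  extension_degree E (simple_extension hE X) (size mu).-1.
Proof.
move=> mu_min; have [monmu Emu rmu _] := mu_min.
have mu0 : (0 < size mu)%N by rewrite size_poly_gt0 monic_neq0.
split; first exact: simple_extension_base.
have hornerE_pow (c : 'rV[F]_(size mu).-1) :
    (rVpoly c).[X] = \sum_i c 0 i * X ^+ i.
  rewrite horner_poly; apply: eq_bigr => i _.
  by rewrite valK.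
have over_rV (c : 'rV[F]_(size mu).-1) :
    (forall i, E (c 0 i)) -> rVpoly c \is a polyOver (subfield_pred hE).
  move=> Ec; apply/polyOverP => i; rewrite coef_rVpoly.
  by case: insub => [j|]; [exact/subfield_predP|exact: rpred0].
exists (fun i => X ^+ i); split=> [i|y [p Ep ->]].
  by exists 'X^i; rewrite ?hornerXn // polyOverXn.
have [_ Er] := polyOver_monic_divmod monmu Emu Ep.
have sz_r : (size (p %% mu)%R <= (size mu).-1)%N.
  by rewrite -ltnS prednK // ltn_modp monic_neq0.
have eq_r : p.[X] = (p %% mu).[X].
  by rewrite {1}(divp_eq p mu) hornerD hornerM (rootP rmu) mulr0 add0r.
exists (poly_rV (p %% mu)); split.
  split=> [i|]; first by rewrite mxE; apply/(subfield_predP hE)/(polyOverP Er).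
  by rewrite -hornerE_pow poly_rV_K.
move=> c [Ec eq_c]; apply: (can_inj rVpolyK); rewrite poly_rV_K //.
apply/eqP; rewrite -subr_eq0; apply: contraT => ne0.
have sz_d : (size (p %% mu - rVpoly c)%R <= (size mu).-1)%N.
  apply: leq_trans (size_polyD _ _) _; rewrite geq_max sz_r size_polyN.
  exact: size_poly.
have := minimal_polynomial_leq mu_min _ ne0; rewrite leqNgt.
rewrite -[X in (_ < X)%N](prednK mu0) ltnS sz_d => /(_ _ _)/contraTT; apply=> //.
  by rewrite rpredB ?over_rV.
by rewrite rootE hornerD hornerN hornerE_pow -eq_c eq_r subrr.
Qed.

Lemma comp_poly_affine_coef (F : fieldType) (p : {poly F}) (x c : F) i :
  (p \Po (x%:P + c *: 'X))`_i = p^`N(i).[x] * c ^+ i.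
Proof.
rewrite /comp_poly nderiv_taylor; last exact: mulrC.
rewrite size_map_polyC coef_sum.
under eq_bigr => j _ do
  rewrite nderivn_map horner_map exprZn /= coefCM coefZ coefXn.
have [lt_i|le_i] := ltnP i (size p); last first.
  rewrite nderivn_poly0 // horner0 mul0r big1 // => j _.
  by rewrite gtn_eqF ?mulr0 // (leq_trans (ltn_ord j)).
rewrite (bigD1 (Ordinal lt_i)) //= eqxx mulr1 big1 ?addr0 // => j ne_j.
by rewrite eq_sym (negPf (ne_j : j != i :> nat)) !mulr0.
Qed.

Section ConjugateCount.
Variables (G : porderZmodType) (hG : ordered_abelian_group G).
Variables (F : closedFieldType) (w : F -> option G) (wv : valuation w).
Variables (E : set F) (hE : is_subfield E) (hensE : henselian w E).
Local Notation O := (vring hG wv).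
Local Notation M := (videal w).
Local Notation "'E" := (subfield_pred hE).

(* The conjugates r of X satisfy w(r - a) = w(X - a), so that the polynomial
   p(X + (a - X) T) - p(X) vanishes at the integral elements (r - X) / (a - X);
   its reduction, after scaling, is T^h. *)
Lemma minimal_polynomial_size_dominant (p : {poly F}) (X a : F) (mu : {poly F}) h :
    minimal_polynomial 'E X mu -> a \in 'E -> X != a ->
    p - (p.[X])%:P \is a polyOver 'E ->
    (0 < h)%N -> p^`N(h).[X] != 0 ->
    (forall i, (0 < i)%N -> i != h ->
      (p^`N(i).[X] * (a - X) ^+ i) / (p^`N(h).[X] * (a - X) ^+ h) \in M) ->
  (size mu <= h.+1)%N.
Proof.
move=> mu_min Ea neXa Ep h0 ch dom; have [monmu Emu rmu min_mu] := mu_min.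
have Xa0 : X - a != 0 by rewrite subr_eq0.
set c := a - X in dom; have c0 : c != 0 by rewrite /c -opprB oppr_eq0.
set t := _ * c ^+ h in dom; have t0 : t != 0 by rewrite mulf_neq0 ?expf_neq0.
have [rs eq_mu] := closed_field_poly_normal mu.
rewrite (monicP monmu) scale1r in eq_mu.
have O_r r : r \in rs -> (r - X) / c \in O.
  move=> rs_r; have rr : root mu r by rewrite eq_mu root_prod_XsubC.
  (* Translation by $a \in E$ makes $r - a$ a root of the minimal polynomial of $X - a$, so that the
     root ratio bound applies. *)
  have [nu nu_min] : exists nu, minimal_polynomial 'E (X - a) nu.
    apply: (@minimal_polynomial_exists _ 'E _ (mu \Po ('X + a%:P))).
    - by rewrite polyOver_comp // polyOverXaddC.
    - by rewrite comp_poly_eq0 ?monic_neq0 // size_XaddC.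
    - by rewrite rootE horner_comp hornerD hornerX hornerC subrK; exact: rmu.
  have [_ Enu rnu _] := nu_min.
  have mu_nu : mu %| nu \Po ('X - a%:P).
    apply: min_mu; last by rewrite rootE horner_comp hornerXsubC.
    by rewrite polyOver_comp // polyOverXsubC.
  have rnur : root nu (r - a).
    by have := root_dvdp mu_nu rr; rewrite rootE horner_comp hornerXsubC.
  have Or := minimal_polynomial_root_ratio hG wv hensE nu_min rnur rnu Xa0.
  have -> : (r - X) / c = 1 - (r - a) / (X - a).
    rewrite -[r - X](subrKA a) addrC mulrDl divff //; congr (1 + _).
    by rewrite /c -[a - X]opprB invrN mulrN.
  by rewrite rpredB ?rpred1.
pose L := X%:P + c *: 'X.
pose D := \prod_(r <- rs) ('X - ((r - X) / c)%:P).
pose g := t^-1 *: ((p - (p.[X])%:P) \Po L).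
have gE i : g`_i = if i == 0%N then 0 else p^`N(i).[X] * c ^+ i / t.
  rewrite /g coefZ comp_polyB comp_polyC coefB comp_poly_affine_coef coefC.
  case: eqP => [->|_]; first by rewrite nderivn0 expr0 mulr1 subrr mulr0.
  by rewrite subr0 mulrC.
have gh : g`_h = 1 by rewrite gE gtn_eqF // divff.
have Mg i : i != h -> g`_i \in M.
  by rewrite gE; case: posnP => [_ _|i0 ne_i]; [exact: videal0 wv|exact: dom].
have Og : g \is a polyOver O.
  apply/polyOverP => i; have [->|ne_i] := eqVneq i h; first by rewrite gh rpred1.
  exact/(videalW hG wv)/Mg.
have OD : D \is a polyOver O.
  by rewrite /D big_seq rpred_prod // => r rs_r; rewrite polyOverXsubC O_r.
have monD : D \is monic by apply: monic_prod => r _; exact: monicXsubC.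
(* Under $T \mapsto X + cT$ each factor $T - r$ of $\mu$ becomes $c(T - (r - X)/c)$, and $\mu$
   divides $p - p(X)$. *)
have dvdDg : D %| g.
  rewrite /g dvdpZr ?invr_eq0 //.
  have rX : root (p - (p.[X])%:P) X by rewrite rootE !hornerE subrr.
  have [Q ->] := dvdpP _ _ (min_mu _ Ep rX).
  rewrite comp_polyM dvdp_mull // eq_mu (rmorph_prod (comp_poly L)) /=.
  rewrite (eq_bigr (fun r => c%:P * ('X - ((r - X) / c)%:P))).
    by rewrite big_split /= dvdp_mulIr.
  move=> r _; rewrite comp_polyB comp_polyX comp_polyC /L mulrBr -polyCM.
  by rewrite [c * _]mulrC divfK // mul_polyC polyCB opprB addrAC addrC.
have := integral_divisor_size monD OD Og dvdDg _
  (fun i lt_i => Mg i (negbT (gtn_eqF lt_i))).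
rewrite gh (videal1 wv) => /(_ isT); congr (_ <= _)%N.
by rewrite eq_mu !size_prod_XsubC.
Qed.

End ConjugateCount.

Theorem theorem1p4 (p : nat) (K : fieldType) (Omega : closedFieldType)
  (iota : {rmorphism K -> Omega}) (X : Omega)
  (G : porderZmodType) (v : K -> option G) (w : Omega -> option G)
  (d : Order.disp_t) (I : orderType d) (z : I -> K) (f : {poly K})
  (charK : p \in [pchar K]) (odd_p : odd p)
  (X_transcendental : ~ algebraicOver iota X)
  (Omega_algebraic : forall y : Omega, algebraic_over (adjoin iota X) y)
  (G_ordered : ordered_abelian_group G)
  (v_valuation : valuation v) (w_valuation : valuation w)
  (w_extends_v : forall a : K, w (iota a) = v a)
  (KX_immediate : immediate w (range iota) (adjoin iota X))
  (I_limit : limit_ordinal I)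
  (z_pseudo_convergent : pseudo_convergent v z)
  (z_no_limit : ~ exists a : K, is_pseudo_limit v w iota z (iota a))
  (X_limit : is_pseudo_limit v w iota z X)
  (K_henselian : henselian v [set: K])
  (f_nonconstant : (1 < size f)%N) :
  exists2 n : nat,
    extension_degree (henselization w (adjoin iota (map_poly iota f).[X]))
                     (henselization w (adjoin iota X)) n
    & (n <= approximation_degree v w iota z X f)%N.
Proof.
pose P := map_poly iota f; rewrite -/P; set y := P.[X].
set E := henselization w (adjoin iota y).
have hE : is_subfield E by exact: henselization_subfield.
have hensE : henselian w E by exact: henselization_henselian.
have adjE : adjoin iota y `<=` E by exact: sub_henselization.
have EP : P \is a polyOver (subfield_pred hE).
  apply/polyOverP => i; rewrite coef_map /=; apply/subfield_predP; apply: adjE.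
  exact: adjoin_base.
have Ey : y \in subfield_pred hE by apply/subfield_predP; apply: adjE; exact: adjoin_gen.
have EPy : P - y%:P \is a polyOver (subfield_pred hE) by rewrite rpredB ?polyOverC.
have szP : (1 < size P)%N by rewrite size_map_poly.
have Py0 : P - y%:P != 0.
  rewrite -size_poly_gt0 size_polyDl ?size_polyN ?(ltnW szP) //.
  by rewrite (leq_ltn_trans (size_polyC_leq1 _)).
have rPy : root (P - y%:P) X by rewrite rootE !hornerE subrr.
have [mong Eg] := polyOver_monic_scale EPy Py0; set g := _ *: _ in mong Eg.
have rg : root g X by rewrite rootZ // invr_eq0 lead_coef_eq0.
have [mu mu_min] := minimal_polynomial_exists EPy Py0 rPy.
(* $E(X)$ is henselian and contains $K(X)$; conversely $K(X)^h$ is henselian and contains $K(y)$,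
   hence $E$, and also $X$. *)
have -> : henselization w (adjoin iota X) = simple_extension hE X.
  rewrite eqEsubset; split.
    apply: henselization_min; first exact: simple_extension_subfield mong Eg rg.
      exact: simple_extension_henselian mong Eg rg.
    apply: smallest_sub; first exact: simple_extension_subfield mong Eg rg.
    move=> _ [[a _ <-]|->]; last exact: simple_extension_gen.
    by apply: simple_extension_base; apply: adjE; exact: adjoin_base.
  have hH := henselization_subfield w (adjoin iota X).
  have adjH : adjoin iota X `<=` henselization w (adjoin iota X).
    exact: sub_henselization.
  apply: simple_extension_min => //; last by apply: adjH; exact: adjoin_gen.
  apply: henselization_min => //; first exact: henselization_henselian.
  apply: smallest_sub => // _ [[a _ <-]|->].
    by apply: adjH; exact: adjoin_base.
  apply/(subfield_predP hH)/rpred_horner.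
    apply/polyOverP => i; rewrite coef_map /=; apply/subfield_predP; apply: adjH.
    exact: adjoin_base.
  by apply/subfield_predP; apply: adjH; exact: adjoin_gen.
exists (size mu).-1; first exact: extension_degree_simple.
have [h [i0 [h0 ch dom]]] :=
  dominant_taylor_term G_ordered v_valuation w_valuation I_limit
    z_pseudo_convergent X_limit szP.
rewrite (approximation_degree_taylor G_ordered v_valuation w_valuation
  w_extends_v I_limit z_pseudo_convergent X_limit KX_immediate h0 ch dom).
(* One index beyond [i0] suffices: the count is made with $a = z_\nu$, which lies in $K \subseteq
   E$. *)
have [_ _ unb] := I_limit; have [nu lt_nu] := unb i0.
have szmu : (size mu <= h.+1)%N.
  apply: (minimal_polynomial_size_dominant G_ordered w_valuation hensE mu_min
    _ _ EPy h0 ch (dom nu lt_nu)).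
    by apply/subfield_predP; apply: adjE; exact: adjoin_base.
  by rewrite -subr_eq0
    (pseudo_limit_gap_neq0 w_valuation I_limit z_pseudo_convergent X_limit).
by rewrite -ltnS prednK // size_poly_gt0 monic_neq0 //; case: mu_min.
Qed.
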